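(* For the resolved conifold with one special outer brane and framing $a$, let $$Z = \exp \left(\sum_{n \geq 1} \frac{1}{n!} \sum_{g \geq 0} \lambda^{2g-2+n}\,\Phi_{g,n}(x, \dots ,x)\right),$$ where $\Phi_{g,n}(x_1,\dots,x_n)$ are the symmetrized generating series of the open string amplitudes $\tilde F^{(a)}_{g;k;\mu}$. Then, with $q=e^{\sqrt{-1}\lambda}$, $$(1- \hat{y} + q^{1/2}\,\hat{x}\,\hat{y}^{a+1} - q^{1/2}e^{-t}\, \hat{x}\, \hat{y}^{a} )\, Z = 0,$$ where $\hat{x} = x\,\cdot$ (multiplication by $x$) and $\hat{y} = e^{\sqrt{-1}\lambda x \frac{\partial}{\partial x}}$.
   Context: Notation: $a$ is the framing (an arbitrary complex number), $q=e^{\sqrt{-1}\lambda}$ (with $q^b=e^{\sqrt{-1}b\lambda}$), $Q=-e^{-t}$, $[n]=q^{n/2}-q^{-n/2}$, $\kappa_\mu=\sum_i\mu_i(\mu_i-2i+1)$, $\chi_\mu(\eta)$ is the value of the irreducible symmetric group character indexed by $\mu$ on the class of cycle type $\eta$, $z_\eta$ is the order of the centralizer of an element of cycle type $\eta$, $p_\eta=\prod_i p_{\eta_i}$, $\nu^t$ is the conjugate partition, and $(0)$ denotes the empty partition. Symmetric functions are specialized at $q^\rho=(q^{-1/2},q^{-3/2},\dots)$, i.e. $p_n(q^\rho)=1/[n]$. The topological vertices $C_{\mu^1,\mu^2,\mu^3}(q)$ needed are $$C_{\mu,(0),\nu^t}(q)=q^{-\kappa_\nu/2}\sum_{\eta}s_{\mu/\eta}(q^\rho)\,s_{\nu/\eta}(q^\rho),\qquad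 C_{\nu,(0),(0)}(q)=s_\nu(q^\rho),$$ with $s_{\mu/\eta}$ skew Schur functions. The open string amplitude is $$\tilde{Z}^{(a)}(\lambda;t;\mathbf{p})=\sum_{\mu,\nu,\eta}q^{a\kappa_\mu/2}\,C_{\mu,(0),\nu^t}(q)\,Q^{|\nu|}\,C_{\nu,(0),(0)}(q)\,\frac{\chi_\mu(\eta)}{z_\eta\sqrt{-1}^{\,l(\eta)}}\,p_\eta$$ (the sum over partitions with $|\eta|=|\mu|$), and its normalization is $\hat{\tilde Z}^{(a)}(\lambda;t;\mathbf{p})=\tilde Z^{(a)}(\lambda;t;\mathbf{p})/\tilde Z^{(a)}(\lambda;t;\mathbf{p})|_{\mathbf{p}=\mathbf{0}}$. The coefficients $\tilde F^{(a)}_{g;k;\mu}$ are defined by $$\hat{\tilde Z}^{(a)}(\lambda;t;\mathbf{p})=\exp\sum_{\mu\in\mathcal{P}^+}\sum_{g=0}^\infty\sum_{k=0}^\infty\tilde F^{(a)}_{g;k;\mu}\,\lambda^{2g-2+l(\mu)}e^{-kt}p_\mu,$$ where $\mathcal{P}^+$ is the set of nonempty partitions. It is a known theorem (full Mari\~no--Vafa conjecture) that $$\exp\sum_{\mu\in\mathcal{P}^+}\sum_{g,k\ge0}\sqrt{-1}^{\,l(\mu)}\tilde F^{(a)}_{g;k;\mu}\lambda^{2g-2+l(\mu)}e^{(|\mu|/2-k)t}p_\mu=\sum_\mu s_\mu\,q^{a\kappa_\mu/2}\dim_qR_\mu,$$ where $\dim_qR_\mu=s_\mu(\mathbf{y})$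 is the Schur function specialized by $p_n(\mathbf{y})=(e^{nt/2}-e^{-nt/2})/[n]$ for $n\ge1$. For $g\ge0$, $n\ge1$ define $$\Phi_{g,n}(x_1,\dots,x_n)=\sum_{l(\mu)=n}\sum_{k\ge0}\sqrt{-1}^{\,n}\,\tilde F^{(a)}_{g;k;\mu}\,e^{-kt}\sum_{\sigma\in S_n}x_{\sigma(1)}^{\mu_1}\cdots x_{\sigma(n)}^{\mu_n}.$$ $\Phi_{g,n}(x,\dots,x)$ means setting all $x_i=x$. $Z$ is a formal power series in $x$, with coefficients expanded as power series in $e^{-t}$ and Laurent series in $\lambda$. The operator $\hat y^{\,b}$, for a complex number $b$, acts coefficientwise by $x^n\mapsto q^{bn}x^n$. *)

(* Defs.v *)
From HB Require Import structures.
From mathcomp Require Import all_boot all_order all_algebra all_fingroup.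
From mathcomp Require Import mxrepresentation boolp reals complex.

Set Implicit Arguments.
Unset Strict Implicit.
Unset Printing Implicit Defensive.

Import Order.TTheory GRing.Theory Num.Theory.
Local Open Scope ring_scope.

Record fps (A : Type) : Type := Fps { coefs : nat -> A }.

Notation "{ 'fps' A }" := (fps A) (at level 0, format "{ 'fps'  A }") : type_scope.
Notation "\fps_ n E" := (Fps (fun n : nat => E))
  (at level 36, E at level 36, n at level 1, format "\fps_ n  E") : ring_scope.

HB.instance Definition _ (A : Type) := gen_eqMixin (fps A).
HB.instance Definition _ (A : Type) := gen_choiceMixin (fps A).

Lemma fpsP (A : Type) (f g : {fps A}) : coefs f =1 coefs g -> f = g.
Proof. by case: f g => [f] [g] /= /funext ->. Qed.

Section FpsZmod.
Variable A : zmodType.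
Implicit Types f g : {fps A}.

Definition fps_zero : {fps A} := \fps_n 0.
Definition fps_add f g : {fps A} := \fps_n (coefs f n + coefs g n).
Definition fps_opp f : {fps A} := \fps_n (- coefs f n).

Fact fps_addA : associative fps_add.
Proof. by move=> f g h; apply: fpsP => n /=; rewrite addrA. Qed.
Fact fps_addC : commutative fps_add.
Proof. by move=> f g; apply: fpsP => n /=; rewrite addrC. Qed.
Fact fps_add0 : left_id fps_zero fps_add.
Proof. by move=> f; apply: fpsP => n /=; rewrite add0r. Qed.
Fact fps_addN : left_inverse fps_zero fps_opp fps_add.
Proof. by move=> f; apply: fpsP => n /=; rewrite addNr. Qed.

HB.instance Definition _ :=
  GRing.isZmodule.Build (fps A) fps_addA fps_addC fps_add0 fps_addN.

End FpsZmod.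

Section FpsRing.
Variable A : comNzRingType.
Implicit Types f g : {fps A}.

Definition fps_const (c : A) : {fps A} := \fps_n (if n is 0%N then c else 0).
Definition fps_X : {fps A} := \fps_n (n == 1)%N%:R.
Definition fps_mul f g : {fps A} :=
  \fps_n (\sum_(i < n.+1) coefs f i * coefs g (n - i)).

Lemma coefs_mul_poly f g N n : (n < N)%N ->
  coefs (fps_mul f g) n
  = (\poly_(i < N) coefs f i * \poly_(i < N) coefs g i)`_n.
Proof.
move=> nN; rewrite coefM; apply: eq_bigr => i _.
rewrite !coef_poly (leq_ltn_trans (leq_subr _ _) nN).
by rewrite (leq_ltn_trans _ nN) // -ltnS.
Qed.

Fact fps_mulA : associative fps_mul.
Proof.
move=> f g h; apply: fpsP => n.
have trunc (u v : {poly A}) (w : {poly A}) :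
    (forall i, (i <= n)%N -> u`_i = v`_i) -> (u * w)`_n = (v * w)`_n.
  by move=> uv; rewrite !coefM; apply: eq_bigr => i _; rewrite uv // -ltnS.
have tr (a b : {fps A}) i : (i <= n)%N ->
    (\poly_(j < n.+1) coefs (fps_mul a b) j)`_i
    = (\poly_(j < n.+1) coefs a j * \poly_(j < n.+1) coefs b j)`_i.
  by move=> le_in; rewrite coef_poly ltnS le_in (@coefs_mul_poly _ _ n.+1).
rewrite !(@coefs_mul_poly _ _ n.+1) //.
rewrite mulrC (trunc _ _ _ (tr g h)) mulrC mulrA.
by rewrite -(trunc _ _ _ (tr f g)).
Qed.

Fact fps_mulC : commutative fps_mul.
Proof.
move=> f g; apply: fpsP => n.
by rewrite !(@coefs_mul_poly _ _ n.+1) // mulrC.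
Qed.

Fact fps_mul1 : left_id (fps_const 1) fps_mul.
Proof.
move=> f; apply: fpsP => n /=.
rewrite big_ord_recl /= subn0 mul1r big1 ?addr0 // => i _.
by rewrite /= mul0r.
Qed.

Fact fps_mulDl : left_distributive fps_mul +%R.
Proof.
move=> f g h; apply: fpsP => n /=; rewrite -big_split.
by apply: eq_bigr => i _; rewrite /= mulrDl.
Qed.

Fact fps_1neq0 : fps_const 1 != 0.
Proof.
by apply/eqP => /(congr1 (fun f => coefs f 0%N)) /= /eqP; rewrite oner_eq0.
Qed.

HB.instance Definition _ := GRing.Zmodule_isComNzRing.Build (fps A)
  fps_mulA fps_mulC fps_mul1 fps_mulDl fps_1neq0.

Lemma coefsM f g n :
  coefs (f * g) n = \sum_(i < n.+1) coefs f i * coefs g (n - i).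
Proof. by []. Qed.
Lemma coefsD f g n : coefs (f + g) n = coefs f n + coefs g n.
Proof. by []. Qed.
Lemma coefsN f n : coefs (- f) n = - coefs f n.
Proof. by []. Qed.
Lemma coefs1 n : coefs (1 : {fps A}) n = (n == 0%N)%:R.
Proof. by case: n. Qed.
Lemma coefs0 n : coefs (0 : {fps A}) n = 0.
Proof. by []. Qed.

End FpsRing.

Arguments fps_X {A}.

Section FpsUnitRing.
Variable A : comUnitRingType.
Implicit Types f g : {fps A}.

Fixpoint fps_inv_seq f n : seq A :=
  if n is n'.+1 then
    let s := fps_inv_seq f n' in
    rcons s ((coefs f 0)^-1 *
             ((n' == 0)%N%:R - \sum_(i < n') coefs f (n' - i) * s`_i))
  else [::].

Definition fps_unit : {pred {fps A}} := fun f => coefs f 0 \is a GRing.unit.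
Definition fps_inv f : {fps A} :=
  if f \in fps_unit then \fps_n ((fps_inv_seq f n.+1)`_n) else f.

Lemma size_fps_inv_seq f n : size (fps_inv_seq f n) = n.
Proof. by elim: n => //= n IH; rewrite size_rcons IH. Qed.

Lemma nth_fps_inv_seq f n i : (i < n)%N ->
  (fps_inv_seq f n)`_i = (fps_inv_seq f i.+1)`_i.
Proof.
elim: n => // n IH; rewrite ltnS leq_eqVlt => /orP[/eqP->//|lt_in].
by rewrite /= nth_rcons size_fps_inv_seq lt_in IH.
Qed.

Fact fps_mulV : {in fps_unit, left_inverse 1 fps_inv *%R}.
Proof.
move=> f fU; rewrite mulrC /fps_inv fU; apply: fpsP => n.
rewrite coefsM coefs1 -(big_mkord predT
  (fun i => coefs f i * (fps_inv_seq f (n - i).+1)`_(n - i))).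
rewrite big_nat_rev /= add0n.
under eq_big_nat => i lt_in do rewrite subSS subKn //.
rewrite big_nat_recr //= subnn nth_rcons size_fps_inv_seq ltnn eqxx.
rewrite mulVKr // big_mkord addrC.
rewrite [X in _ + X](eq_bigr (fun i : 'I_n => coefs f (n - i) * (fps_inv_seq f n)`_i)).
  by rewrite subrK.
by move=> i _; rewrite (nth_fps_inv_seq f (ltn_ord i)).
Qed.

Fact fps_unitP f g : g * f = 1 -> f \in fps_unit.
Proof.
move/(congr1 (fun h => coefs h 0%N)); rewrite coefsM big_ord1 coefs1 /= => gf1.
by rewrite /fps_unit unfold_in; apply/unitrPr; exists (coefs g 0); rewrite mulrC.
Qed.

Fact fps_inv_out : {in [predC fps_unit], fps_inv =1 id}.
Proof. by move=> f; rewrite inE /fps_inv => /negbTE->. Qed.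

HB.instance Definition _ := GRing.ComNzRing_hasMulInverse.Build (fps A)
  fps_mulV fps_unitP fps_inv_out.

(* Meaningful when [coefs f 0 = 0]: then [f ^+ n] has no term of degree < n. *)
Definition fps_exp f : {fps A} :=
  \fps_d (\sum_(n < d.+1) (n`!%:R)^-1 * coefs (f ^+ n) d).

End FpsUnitRing.

Section FpsIdomain.
Variable A : idomainType.

Fact fps_idomain (f g : {fps A}) : f * g = 0 -> (f == 0) || (g == 0).
Proof.
apply: contra_eqT; rewrite negb_or => /andP[nzf nzg].
have low (h : {fps A}) : h != 0 ->
    exists2 m, coefs h m != 0 & forall i, (i < m)%N -> coefs h i = 0.
  move=> nzh; have ex : exists m, coefs h m != 0.
    apply/not_existsP => h0; move/eqP: nzh; apply; apply: fpsP => n.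
    by have /negP := h0 n; rewrite negbK => /eqP.
  exists (ex_minn ex); case: ex_minnP => // m _ min i.
  by rewrite ltnNge; apply: contraNeq => /min.
have [m fm f_lt] := low f nzf; have [n gn g_lt] := low g nzg.
apply/eqP => /(congr1 (fun h => coefs h (m + n)%N)); rewrite coefsM coefs0.
have lt_m : (m < (m + n).+1)%N by rewrite ltnS leq_addr.
rewrite (bigD1 (Ordinal lt_m)) //= addKn big1 ?addr0.
  by apply/eqP; rewrite mulf_neq0.
move=> i; rewrite -val_eqE /= neq_ltn => /orP[/f_lt->|lt_mi]; first exact: mul0r.
by rewrite g_lt ?mulr0 // ltn_subLR ?ltn_add2r // -ltnS.
Qed.

HB.instance Definition _ :=
  GRing.ComUnitRing_isIntegral.Build (fps A) fps_idomain.

End FpsIdomain.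

Definition is_partition (mu : seq nat) : bool := sorted geq mu && (0%N \notin mu).

(* The list of all partitions of [n]: such a partition has at most [n] parts,
   each of them at most [n]. *)
Definition partitions (n : nat) : seq (seq nat) :=
  [seq mu <- [seq map val (bseqval s) | s <- enum {: n.-bseq 'I_n.+1}]
  | is_partition mu && (sumn mu == n)].

Lemma partitions_uniq n : uniq (partitions n).
Proof.
apply/filter_uniq; rewrite map_inj_uniq ?enum_uniq // => s t /inj_map st.
by apply: val_inj; apply: st; apply: val_inj.
Qed.

Lemma mem_partitions n mu :
  (mu \in partitions n) = is_partition mu && (sumn mu == n).
Proof.
rewrite mem_filter andb_idr // => /andP[/andP[_ mu0] /eqP mun].
have le_size : (size mu <= n)%N.
  rewrite -mun; elim: mu mu0 {mun} => //= m mu IH.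
  rewrite inE negb_or eq_sym -lt0n => /andP[m_gt0 /IH le_mu].
  by rewrite -add1n leq_add.
have lt_all i : i \in mu -> (i < n.+1)%N.
  rewrite ltnS -mun; elim: mu {mu0 mun le_size} => //= m mu IH.
  rewrite inE => /orP[/eqP->|/IH le_i]; first exact: leq_addr.
  exact: leq_trans le_i (leq_addl _ _).
have le_size' : (size (map (@inord n) mu) <= n)%N by rewrite size_map.
apply/mapP; exists (Bseq le_size'); first by rewrite mem_enum.
rewrite /= -map_comp map_id_in // => i /lt_all lt_i; exact: inordK.
Qed.

Definition kappa (mu : seq nat) : int :=
  \sum_(i < size mu)
    (nth 0%N mu i)%:Z * ((nth 0%N mu i)%:Z - 2%:Z * (i.+1)%:Z + 1).

Definition cycle_type (n : nat) (s : 'S_n) : seq nat :=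
  sort geq [seq #|B| | B : {set 'I_n} in porbits s].

Definition perm_of_type (n : nat) (eta : seq nat) : 'S_n :=
  odflt 1%g [pick s : 'S_n | cycle_type s == eta].

Definition zee (eta : seq nat) : nat := #|'C[perm_of_type (sumn eta) eta]%g|.

Section Specht.
Variables (C : fieldType) (mu : seq nat).
Let n := sumn mu.
Let G : {group 'S_n} := [set: 'S_n]%G.

(* The boxes of the Young diagram of [mu] are numbered row by row: box [k] lies
   in row [reshape_index mu k] and column [reshape_offset mu k]. *)
Definition row_stab : {set 'S_n} :=
  [set s : 'S_n | [forall k, reshape_index mu (s k) == reshape_index mu k]].
Definition col_stab : {set 'S_n} :=
  [set s : 'S_n | [forall k, reshape_offset mu (s k) == reshape_offset mu k]].

(* The Young symmetrizer, as a vector of the regular representation. *)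
Definition young_symmetrizer : 'rV[C]_#|G| :=
  \sum_(r in row_stab) \sum_(c in col_stab)
    (-1) ^+ odd_perm c *: delta_mx 0 (gring_index G (r * c)%g).

Definition specht_repr :=
  submod_repr (cyclic_mx_module (regular_repr C G) young_symmetrizer).

Definition specht_char (eta : seq nat) : C :=
  \tr (specht_repr (perm_of_type n eta)).

End Specht.

Section Schur.
Variables (K : fieldType) (p : nat -> K).

(* sum_n h_n z^n = exp (sum_(n >= 1) p_n z^n / n) *)
Definition hsym (n : nat) : K :=
  coefs (fps_exp (\fps_k (if k is 0%N then 0 else p k / k%:R))) n.

Definition hsymz (m : int) : K := if m is Posz n then hsym n else 0.

(* Jacobi-Trudi; the determinant vanishes unless [eta] is contained in [mu]. *)
Definition skew_schur (mu eta : seq nat) : K :=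
  \det (\matrix_(i < maxn (size mu) (size eta), j < maxn (size mu) (size eta))
          hsymz ((nth 0%N mu i)%:Z - (nth 0%N eta j)%:Z - i%:Z + j%:Z)).

Definition schur (mu : seq nat) : K := skew_schur mu [::].

End Schur.

Section PowerSumSeries.
Variable A : comUnitRingType.
Implicit Types f g : seq nat -> A.

Definition pser_one : seq nat -> A := fun mu => (mu == [::])%:R.

(* p_al * p_be = p_mu when [mu] is the union of the multisets [al] and [be]. *)
Definition pser_mul f g : seq nat -> A := fun mu =>
  \sum_(d < (sumn mu).+1)
    \sum_(al <- partitions d)
      \sum_(be <- partitions (sumn mu - d) | perm_eq (al ++ be) mu)
        f al * g be.

Definition pser_pow f (n : nat) : seq nat -> A := iter n (pser_mul f) pser_one.

(* Meaningful when [f [::] = 0], see [fps_exp]. *)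
Definition pser_exp f : seq nat -> A := fun mu =>
  \sum_(n < (sumn mu).+1) (n`!%:R)^-1 * pser_pow f n mu.

End PowerSumSeries.


Notation "x %:F" := (tofrac x) : ring_scope.

Section Amplitudes.
Variable C : numClosedFieldType.

(* C((lambda)) is the fraction field of C[[lambda]]. *)
Definition laurent : fieldType := {fraction {fps C}}.

Definition lam : {fps C} := fps_X.

Definition scal (c : C) : laurent := (fps_const c)%:F.

(* q ^ b = e ^ (i b lambda) *)
Definition qpow (b : C) : laurent := (fps_exp (fps_const ('i * b) * lam))%:F.

Definition qnum (n : nat) : laurent := qpow (n%:R / 2%:R) - qpow (- (n%:R / 2%:R)).

(* C((lambda))[[T]], where T = e^{-t} *)
Definition coefring : comUnitRingType := {fps laurent}.

Definition T : coefring := fps_X.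
Definition tconst (c : laurent) : coefring := fps_const c.

Definition p_rho (n : nat) : laurent := (qnum n)^-1.

(* The vertex C_(mu, (0), nu^t), as a function of [mu] and [nu] (not of [nu^t]). *)
Definition vertex2 (mu nu : seq nat) : laurent :=
  qpow (- ((kappa nu)%:~R / 2%:R)) *
  \sum_(d < (sumn mu).+1) \sum_(eta <- partitions d)
    skew_schur p_rho mu eta * skew_schur p_rho nu eta.

(* C_(nu, (0), (0)) *)
Definition vertex1 (nu : seq nat) : laurent := schur p_rho nu.

(* The coefficient of p_eta in the amplitude.  As Q = - T, the partitions [nu]
   of [m] contribute to T^m with Q^|nu| = (-1)^m T^m. *)
Definition open_amplitude (a : C) (eta : seq nat) : coefring :=
  \fps_m
    (\sum_(nu <- partitions m) \sum_(mu <- partitions (sumn eta))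
       qpow (a * (kappa mu)%:~R / 2%:R) * vertex2 mu nu * (-1) ^+ m * vertex1 nu *
       scal (specht_char C mu eta / ((zee eta)%:R * 'i ^+ size eta))).

Definition open_amplitude_normalized (a : C) (eta : seq nat) : coefring :=
  open_amplitude a eta / open_amplitude a [::].

(* sum_(g >= 0) lambda ^ (2g - 2 + n) f_g  for  f_g in C[[T]] *)
Definition genus_sum (n : nat) (f : nat -> {fps C}) : coefring :=
  \fps_k ((lam%:F : laurent) ^ (n%:Z - 2%:Z) *
          (\fps_j (if odd j then 0 else coefs (f j./2) k))%:F).

(* sum_(mu nonempty) sum_(g, k) F g k mu lambda^(2g - 2 + l(mu)) T^k p_mu *)
Definition free_energy (F : nat -> nat -> seq nat -> C) (mu : seq nat) : coefring :=
  if mu is [::] then 0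
  else genus_sum (size mu) (fun g => \fps_k (F g k mu)).

Definition is_open_string_amplitude (a : C) (F : nat -> nat -> seq nat -> C) : Prop :=
  forall mu, is_partition mu ->
    open_amplitude_normalized a mu = pser_exp (free_energy F) mu.

(* Phi_(g, n): [Phi F g n al] is the coefficient, a power series in T, of the
   monomial x_1^(al_1) ... x_n^(al_n). The product of the x_(sigma i)^(mu_i) is
   this monomial exactly when al_(sigma i) = mu_i for all i. *)
Definition Phi (F : nat -> nat -> seq nat -> C) (g n : nat)
    (al : 'I_n -> nat) : {fps C} :=
  \sum_(mu <- partitions (\sum_i al i)%N | size mu == n)
    \sum_(sigma : 'S_n | [forall i, al (sigma i) == nth 0%N mu i])
      \fps_k ('i ^+ n * F g k mu).

(* f(x, ..., x) for a power series f in n variables. *)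
Definition diag_spec (A : zmodType) (n : nat) (f : ('I_n -> nat) -> A) : {fps A} :=
  \fps_d (\sum_(al : {ffun 'I_n -> 'I_d.+1} | (\sum_i al i)%N == d)
            f (fun i => val (al i))).

(* sum_(n >= 1) 1/n! sum_g lambda^(2g - 2 + n) Phi_(g, n) (x, ..., x);
   Phi_(g, n) (x, ..., x) has no term of degree < n in x. *)
Definition log_wave (F : nat -> nat -> seq nat -> C) : {fps coefring} :=
  \fps_d (\sum_(1 <= n < d.+1) (n`!%:R)^-1 *
            genus_sum n (fun g => coefs (diag_spec (@Phi F g n)) d)).

Definition wave (F : nat -> nat -> seq nat -> C) : {fps coefring} :=
  fps_exp (log_wave F).

Definition xhat (f : {fps coefring}) : {fps coefring} := fps_X * f.

(* yhat ^ b = e ^ (i b lambda x d/dx) multiplies x^n by q^(b n). *)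
Definition yhat (b : C) (f : {fps coefring}) : {fps coefring} :=
  \fps_n (tconst (qpow (b * n%:R)) * coefs f n).

Definition wconst (c : coefring) : {fps coefring} := fps_const c.

End Amplitudes.

Arguments T {C}.

(* Main.v *)
(** Substituting [p_k := i x^k] in the amplitude turns [Z] into a sum over [mu] of terms
    weighted by the average of the irreducible character of [mu], so only the
    one-row partitions [mu = (d)] survive.  The coefficient of [x^d] is then
    [q^(a d (d - 1) / 2)] times a sum over [nu] and [j] of
    [(-T)^|nu| h_(d - j) q^(- kappa_nu / 2) s_nu s_(nu / (j))] at [q^rho].  Since
    [q^(- kappa_nu / 2) s_nu (q^rho)] is the Jacobi-Trudi determinant in the
    elementary functions [e_n = q^(- n (n - 1) / 2) h_n], the adjointness of
    multiplication by [e_j] and of skewing by [(j)] gives [(-T)^j e_j] times the sum with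
    [j = 0]; that sum is the normalization.  Hence the coefficient of [x^d] in [Z] is
    [q^(a d (d - 1) / 2) sum_j h_(d - j) (-T)^j e_j], and the q-difference equations of
    the generating series of the [h_n] and [e_n] give the theorem.
    The adjointness is the Cauchy-Binet formula applied to a Toeplitz
    matrix with symbol [E(T/z) H(z)], from which the factor [E(T/z)] is divided out. *)

From HB Require Import structures.
Require Import Defs.
From mathcomp Require Import all_boot all_order all_algebra all_fingroup.
From mathcomp Require Import mxrepresentation boolp reals complex zify ring.

Set Implicit Arguments.
Unset Strict Implicit.
Unset Printing Implicit Defensive.

Import Order.TTheory GRing.Theory Num.Theory.
Local Open Scope ring_scope.

(** * Formal power series *)

(** The value [i x^k] is forced by the factors [i]: [Phi] carries [i^n] and the amplitude
    [i^(- l(eta))], so they cancel and leave the sum over [eta] of [chi_mu(eta) / z_eta], the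
    multiplicity of the trivial representation. For two or more rows it vanishes by the column
    antisymmetry of the Young symmetrizer. The determinant in the [e_n] stands for the Schur
    function of the conjugate partition. It is compared with the one in the [h_n] because
    [h_(n - k)] is [h_n] times a fixed Laurent polynomial in [q^n]: both determinants reduce to a
    Vandermonde determinant in the [q^(n_i)]. The obstacle in the adjointness is that skewing by
    [(r)] moves column 0 of the Toeplitz matrix to index [- r], while columns [- r + 1, ..., 0] are
    absent, so column operations cannot simply divide by [E]. Multiplying by the truncation of [E]
    at degree [r] over [E], which is [1 + O(T^(r+1))], skips exactly the absent columns. It leaves
    the single entry [e_r T^r] in column 0, with a cofactor that does not depend on [r]. *)

Section FpsTheory.
Variable A : comNzRingType.
Implicit Types (f g : {fps A}) (c : A).

Lemma coefs_sum (I : Type) (r : seq I) (P : pred I) (G : I -> {fps A}) n :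
  coefs (\sum_(i <- r | P i) G i) n = \sum_(i <- r | P i) coefs (G i) n.
Proof.
by apply: (big_morph (fun f => coefs f n)) => // f g; rewrite coefsD.
Qed.

Lemma coefsMn f m n : coefs (f *+ m) n = coefs f n *+ m.
Proof. by elim: m => // m IH; rewrite !mulrS coefsD IH. Qed.

Lemma coefs_natr m n : coefs (m%:R : {fps A}) n = if n is 0%N then m%:R else 0.
Proof. by rewrite coefsMn coefs1; case: n => //= n; rewrite mul0rn. Qed.

Lemma coefs_constM c f n : coefs (fps_const c * f) n = c * coefs f n.
Proof.
rewrite coefsM big_ord_recl subn0 big1 ?addr0 // => i _.
by rewrite /= mul0r.
Qed.

Lemma coefs_XM f n : coefs (fps_X * f) n = if n is n'.+1 then coefs f n' else 0.
Proof.
rewrite coefsM; case: n => [|n]; first by rewrite big_ord1 mul0r.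
rewrite !big_ord_recl /= mul0r add0r mul1r subSS subn0 big1 ?addr0 // => i _.
by rewrite /= mul0r.
Qed.

Lemma fps_constM c d : fps_const (c * d) = fps_const c * fps_const d.
Proof.
by apply: fpsP => n; rewrite coefs_constM; case: n => //= n; rewrite mulr0.
Qed.

Lemma fps_constD c d : fps_const (c + d) = fps_const c + fps_const d.
Proof.
by apply: fpsP => n; rewrite coefsD; case: n => //= n; rewrite addr0.
Qed.

Lemma coefs_exp_low f n d : coefs f 0 = 0 -> (d < n)%N -> coefs (f ^+ n) d = 0.
Proof.
move=> f0; elim: n d => // n IH d; rewrite ltnS => le_dn.
rewrite exprS coefsM big1 // => -[[|i] /= lt_i] _; first by rewrite f0 mul0r.
rewrite IH ?mulr0 //; lia.
Qed.

Lemma coefs_XnM t f m :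
  coefs (fps_X ^+ t * f) m = if (t <= m)%N then coefs f (m - t) else 0.
Proof.
elim: t m => [|t IH] m; first by rewrite mul1r subn0.
by rewrite exprS -mulrA coefs_XM; case: m => // m; rewrite IH ltnS subSS.
Qed.

Lemma coefs_NXnM t f m :
  coefs ((- fps_X) ^+ t * f) m = if (t <= m)%N then (-1) ^+ t * coefs f (m - t) else 0.
Proof.
elim: t m => [|t IH] m; first by rewrite !mul1r subn0.
rewrite exprS -mulrA mulNr coefsN coefs_XM; case: m => [|m]; first by rewrite oppr0.
by rewrite IH ltnS subSS exprS mulN1r; case: leqP; rewrite ?oppr0 ?mulNr.
Qed.

(** The derivation [z d/dz]; unlike [d/dz] it commutes with every rescaling of [z]
    ([fps_euler_scale]). *)
Definition fps_euler f : {fps A} := \fps_n (n%:R * coefs f n).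

Lemma fps_eulerM f g : fps_euler (f * g) = fps_euler f * g + f * fps_euler g.
Proof.
apply: fpsP => n; rewrite coefsD !coefsM /= mulr_sumr -big_split /=.
apply: eq_bigr => i _.
have -> : n%:R = i%:R + (n - i)%:R :> A by rewrite -natrD subnKC // -ltnS.
ring.
Qed.

Lemma fps_eulerX f n : fps_euler (f ^+ n.+1) = n.+1%:R * f ^+ n * fps_euler f.
Proof.
elim: n => [|n IH]; first by rewrite expr1 expr0 mul1r mul1r.
by rewrite exprS fps_eulerM IH -[n.+2]addn1 natrD exprS; ring.
Qed.

Lemma fps_euler_const c : fps_euler (fps_const c) = 0.
Proof. by apply: fpsP => -[|n] /=; rewrite ?mul0r ?mulr0. Qed.

Lemma fps_euler_constM c f : fps_euler (fps_const c * f) = fps_const c * fps_euler f.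
Proof. by rewrite fps_eulerM fps_euler_const mul0r add0r. Qed.

Lemma fps_eulerD f g : fps_euler (f + g) = fps_euler f + fps_euler g.
Proof. by apply: fpsP => n; rewrite coefsD /= mulrDr. Qed.

Lemma fps_eulerN f : fps_euler (- f) = - fps_euler f.
Proof. by apply: fpsP => n; rewrite coefsN /= mulrN. Qed.

Lemma fps_eulerXE : fps_euler (fps_X : {fps A}) = fps_X.
Proof. by apply: fpsP => -[|[|n]] /=; rewrite ?mulr0 ?mulr1. Qed.

End FpsTheory.

Lemma fps_unitE (A : comUnitRingType) (f : {fps A}) :
  (f \is a GRing.unit) = (coefs f 0 \is a GRing.unit).
Proof. by []. Qed.

(** * Exponentials characterized by their Euler equation *)

Section FpsExp.
Variable A : comUnitRingType.
Hypothesis natU : forall n, n.+1%:R \is a @GRing.unit A.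
Implicit Types f g : {fps A}.

Lemma fact_unit n : n`!%:R \is a @GRing.unit A.
Proof. by case: n`! (fact_gt0 n). Qed.

Lemma fps_exp0 f : coefs (fps_exp f) 0 = 1.
Proof. by rewrite /= big_ord1 expr0 coefs1 fact0 invr1 mulr1. Qed.

Lemma fps_euler_exp f : coefs f 0 = 0 ->
  fps_euler (fps_exp f) = fps_euler f * fps_exp f.
Proof.
move=> f0; apply: fpsP => -[|d].
  by rewrite coefsM big_ord1 /= !mul0r.
rewrite coefsM [LHS]/= big_ord_recl expr0 coefs1 mulr0 add0r mulr_sumr.
transitivity (\sum_(i < d.+1) (i`!%:R)^-1 * coefs (fps_euler f * f ^+ i) d.+1).
  apply: eq_bigr => i _.
  have -> : fps_euler f * f ^+ i = fps_const (i.+1%:R)^-1 * fps_euler (f ^+ i.+1).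
    rewrite fps_eulerX; apply: fpsP => k.
    rewrite -mulrA coefs_constM mulr_natl coefsMn -(mulr_natl (coefs _ _)).
    by rewrite mulKr // mulrC.
  rewrite coefs_constM /= /bump /= add1n factS natrM invrM ?fact_unit //.
  ring.
under eq_bigr => i _ do rewrite coefsM mulr_sumr.
rewrite exchange_big /=; apply: eq_bigr => k _.
under eq_bigr => i _ do rewrite mulrCA.
rewrite -mulr_sumr; case: k => -[|k] /= lt_k; first by rewrite !mul0r.
congr (_ * _); rewrite subSS.
rewrite -(big_mkord predT (fun i => (i`!%:R)^-1 * coefs (f ^+ i) (d - k))).
(* As [f ^+ i] starts in degree [i], the terms with [i > d - k] vanish; what remains is the
   truncated sum that defines coefficient [d - k] of the exponential. *)
rewrite (@big_cat_nat _ _ _ (d - k).+1) /=; [|lia..].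
rewrite big_mkord [X in _ + X]big_nat [X in _ + X]big1 ?addr0 // => i lt_i.
by rewrite coefs_exp_low ?mulr0 //; lia.
Qed.

(** [fps_euler f] has no constant term and [n.+1] is invertible, so the equation determines each
    coefficient of [g] from the lower ones. Products, rescalings and the trivial exponential are all
    identified through this criterion. *)
Lemma fps_exp_unique f g : coefs f 0 = 0 -> coefs g 0 = 1 ->
  fps_euler g = fps_euler f * g -> g = fps_exp f.
Proof.
move=> f0 g0 eg; have rec h n : fps_euler h = fps_euler f * h ->
    n.+1%:R * coefs h n.+1
    = \sum_(i < n.+1) i.+1%:R * coefs f i.+1 * coefs h (n - i).
  move=> /(congr1 (fun h => coefs h n.+1)).
  by rewrite coefsM big_ord_recl [coefs (fps_euler f) _]mul0r mul0r add0r.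
apply: fpsP => n; elim/ltn_ind: n => -[|n] IH; first by rewrite fps_exp0.
apply: (mulrI (natU n)); rewrite !rec // ?fps_euler_exp //.
by apply: eq_bigr => i _; rewrite IH //; lia.
Qed.

Lemma fps_expD f g : coefs f 0 = 0 -> coefs g 0 = 0 ->
  fps_exp (f + g) = fps_exp f * fps_exp g.
Proof.
move=> f0 g0; apply/esym/fps_exp_unique.
- by rewrite coefsD f0 g0 addr0.
- by rewrite coefsM big_ord1 !fps_exp0 mulr1.
by rewrite fps_eulerM !fps_euler_exp // fps_eulerD; ring.
Qed.

End FpsExp.

Lemma det_mul_rows (A : comNzRingType) N (c : 'I_N -> A) (M : 'M[A]_N) :
  \det (\matrix_(i, j) (c i * M i j)) = (\prod_i c i) * \det M.
Proof.
have -> : \prod_i c i = \det (diag_mx (\row_i c i)).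
  by rewrite det_diag; apply: eq_bigr => i _; rewrite mxE.
rewrite -det_mulmx; congr (\det _); apply/matrixP => i j.
by rewrite mul_diag_mx !mxE.
Qed.

(** * Rescaling the variable and q-difference equations *)

Section FpsScale.
Variable A : comNzRingType.
Implicit Types (f g : {fps A}) (c : A).

Definition fps_scale c f : {fps A} := \fps_n (c ^+ n * coefs f n).

Lemma fps_scaleM c f g : fps_scale c (f * g) = fps_scale c f * fps_scale c g.
Proof.
apply: fpsP => n; rewrite !coefsM [LHS]/= mulr_sumr; apply: eq_bigr => i _ /=.
have -> : c ^+ n = c ^+ i * c ^+ (n - i) by rewrite -exprD subnKC // -ltnS.
ring.
Qed.

Lemma fps_euler_scale c f : fps_euler (fps_scale c f) = fps_scale c (fps_euler f).
Proof. by apply: fpsP => n /=; rewrite mulrCA. Qed.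

(* In terms of generating series: u(Qz) (1 - sz) = u(z) and v(Qz) = (1 + stz) v(z). *)
Lemma convolution_q_rec (Q s t : A) (u v : nat -> A) :
  (forall n, u n.+1 * (Q ^+ n.+1 - 1) = s * Q ^+ n * u n) ->
  (forall n, v n.+1 * (Q ^+ n.+1 - 1) = s * t * v n) ->
  let w d := \sum_(j < d.+1) v j * u (d - j)%N in
  forall d, w d.+1 * (Q ^+ d.+1 - 1) = s * (Q ^+ d + t) * w d.
Proof.
move=> u_rec v_rec w d.
pose U : {fps A} := \fps_n u n; pose V : {fps A} := \fps_n v n.
have UE : fps_scale Q U * (1 - fps_const s * fps_X) = U.
  apply: fpsP => -[|n]; rewrite mulrBr mulr1 coefsD coefsN mulrCA coefs_constM
    (mulrC _ fps_X) coefs_XM /= ?expr0 ?mul1r ?mulr0 ?subr0 //.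
  transitivity (Q ^+ n.+1 * u n.+1 - u n.+1 * (Q ^+ n.+1 - 1)); last by ring.
  by rewrite u_rec; ring.
have VE : fps_scale Q V = (1 + fps_const (s * t) * fps_X) * V.
  apply: fpsP => -[|n]; rewrite mulrDl mul1r coefsD -mulrA coefs_constM coefs_XM
    /= ?expr0 ?mul1r ?mulr0 ?addr0 //.
  by rewrite -v_rec; ring.
have E : fps_scale Q (V * U) * (1 - fps_const s * fps_X)
    = (1 + fps_const (s * t) * fps_X) * (V * U).
  by rewrite fps_scaleM -mulrA UE VE mulrA.
have wE k : coefs (V * U) k = w k by [].
have := congr1 (fun f => coefs f d.+1) E.
rewrite mulrBr mulr1 coefsD coefsN mulrCA coefs_constM (mulrC _ fps_X) coefs_XM.
rewrite mulrDl mul1r coefsD -[in RHS]mulrA coefs_constM coefs_XM.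
rewrite -[coefs (fps_scale _ _) d.+1]/(Q ^+ d.+1 * coefs (V * U) d.+1).
rewrite -[coefs (fps_scale _ _) d]/(Q ^+ d * coefs (V * U) d) !wE => e.
have -> : w d.+1 * (Q ^+ d.+1 - 1)
    = (Q ^+ d.+1 * w d.+1 - s * (Q ^+ d * w d)) - w d.+1 + s * (Q ^+ d * w d) by ring.
by rewrite e; ring.
Qed.

End FpsScale.

Section CompleteSymmetric.
Variables (K : fieldType) (s : K).
Hypothesis natK : forall n, n.+1%:R != 0 :> K.
Hypothesis s_neq0 : s != 0.
Hypothesis s_free : forall n, s ^+ n.+1 - s ^- n.+1 != 0.

Lemma hsym0 (p : nat -> K) : hsym p 0 = 1.
Proof. exact: fps_exp0. Qed.

(* With p_n = 1/[n] one has p_n (q^n - 1) = q^(n/2), so that the generating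
   series satisfies H(qz) (1 - q^(1/2) z) = H(z). *)
Lemma hsym_rec (p : nat -> K) (pE : forall n, p n.+1 = (s ^+ n.+1 - s ^- n.+1)^-1) n :
  hsym p n.+1 * (s ^+ 2 ^+ n.+1 - 1) = s ^+ n.*2.+1 * hsym p n.
Proof.
set f : {fps K} := \fps_k (if k is 0%N then 0 else p k / k%:R).
set H := fps_exp f.
have natU k : k.+1%:R \is a @GRing.unit K by rewrite unitfE.
have f0 : coefs f 0 = 0 by [].
have eH : fps_euler H = fps_euler f * H by exact: fps_euler_exp.
set u := 1 - fps_const s * fps_X.
(* The difference is the geometric series [s z + (s z)^2 + ...], whose denominator is [u]. *)
have shift : (fps_scale (s ^+ 2) (fps_euler f) - fps_euler f) * u = fps_const s * fps_X.
  have -> : fps_scale (s ^+ 2) (fps_euler f) - fps_euler f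
      = \fps_k (if k is 0%N then 0 else s ^+ k).
    apply: fpsP => -[|k].
      by rewrite coefsD coefsN /= !mul0r mulr0 subr0.
    have ek : coefs (fps_euler f) k.+1 = (s ^+ k.+1 - s ^- k.+1)^-1.
      by rewrite /= mulrC divfK // pE.
    rewrite coefsD coefsN.
    have -> : coefs (fps_scale (s ^+ 2) (fps_euler f)) k.+1
       = s ^+ 2 ^+ k.+1 * coefs (fps_euler f) k.+1 by [].
    rewrite ek -[X in _ - X]mul1r -mulrBl exprAC expr2 /=.
    by apply: (canLR (mulfK (s_free k))); rewrite mulrBr mulfV ?expf_neq0.
  apply: fpsP => k; rewrite mulrBr mulr1 mulrCA coefsD coefsN !coefs_constM.
  rewrite (mulrC _ fps_X) coefs_XM; case: k => [|[|k]] /=; rewrite ?mulr0 ?mulr1 ?subr0 //.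
  by rewrite -exprS subrr.
(* Both sides solve the Euler equation of [H]: by [shift], what rescaling adds to the logarithmic
   derivative is cancelled by the contribution of [u]. *)
have GH : fps_scale (s ^+ 2) H * u = H.
  apply: fps_exp_unique => //.
    rewrite coefsM big_ord1 subnn coefsD coefsN coefs1 coefs_constM /=.
    by rewrite mulr0 subr0 mulr1 expr0 mul1r; exact: fps_exp0.
  have eu : fps_euler u = - (fps_const s * fps_X).
    rewrite fps_eulerD fps_eulerN fps_euler_constM fps_eulerXE.
    have -> : (1 : {fps K}) = fps_const 1 by [].
    by rewrite fps_euler_const sub0r.
  rewrite fps_eulerM eu fps_euler_scale eH fps_scaleM.
  rewrite -shift; ring.
have := congr1 (fun g => coefs g n.+1) GH.
rewrite /u mulrBr mulr1 coefsD coefsN mulrCA coefs_constM (mulrC _ fps_X) coefs_XM.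
rewrite -[coefs H n.+1]/(hsym p n.+1).
rewrite -[coefs (fps_scale _ H) n.+1]/(s ^+ 2 ^+ n.+1 * hsym p n.+1).
rewrite -[coefs (fps_scale _ H) n]/(s ^+ 2 ^+ n * hsym p n) => e.
rewrite mulrBr mulr1 mulrC -[X in _ - X]e opprB addrC subrK mulrA.
by rewrite -exprM mul2n -exprS.
Qed.

End CompleteSymmetric.

(** * Jacobi-Trudi determinants *)

Section JacobiTrudi.
Variable K : fieldType.
Implicit Types (h : nat -> K) (nu : seq nat).

(** [hsymz] freed from the power sums, so that the same determinants can be formed with [elsym]. *)
Definition seqz h (m : int) : K := if m is Posz n then h n else 0.

Lemma seqzB h (m n : nat) : seqz h (m%:Z - n%:Z) = if (n <= m)%N then h (m - n)%N else 0.
Proof.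
case: leqP => [le_nm|lt_mn]; first by rewrite subzn.
by have -> : m%:Z - n%:Z = Negz (n - m).-1 by lia.
Qed.

Lemma seqz_neg h (m : int) : m < 0 -> seqz h m = 0.
Proof. by case: m. Qed.

Definition onerow (r : nat) : seq nat := if r is 0%N then [::] else [:: r].

Lemma nth_onerow r j : nth 0%N (onerow r) j = if j == 0%N then r else 0%N.
Proof. by case: r j => [|r] [|[|j]]. Qed.

Lemma size_onerow r : size (onerow r) = (0 < r)%N.
Proof. by case: r. Qed.

Lemma sumn_onerow r : sumn (onerow r) = r.
Proof. by case: r => //= r; rewrite addn0. Qed.

(** The size [N] is free so that all partitions in a sum can share one matrix size; the inner
    partition is a single row [(r)]. *)
Definition jacobi_trudi N h nu r : K :=
  \det (\matrix_(i < N, j < N)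
    seqz h ((nth 0%N nu i)%:Z - (nth 0%N (onerow r) j)%:Z - i%:Z + j%:Z)).

(** The last row of the larger matrix is [(0, ..., 0, 1)]: [nu] has no part there, and the other
    indices are negative. *)
Lemma jacobi_trudiS N h nu r : h 0%N = 1 ->
  (size nu <= N)%N -> (size (onerow r) <= N)%N ->
  jacobi_trudi N.+1 h nu r = jacobi_trudi N h nu r.
Proof.
move=> h0 le_nu le_r; rewrite /jacobi_trudi (expand_det_row _ ord_max).
rewrite (bigD1 ord_max) //= big1 ?addr0; last first.
  move=> j; rewrite -val_eqE /= => neq_jN; rewrite mxE nth_default //.
  rewrite seqz_neg ?mul0r //=; have := ltn_ord j; lia.
rewrite mxE nth_default // nth_default // subrr sub0r addrC subrr /= h0 mul1r.
rewrite /cofactor addnn -signr_odd odd_double mul1r; congr (\det _).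
apply/matrixP => i j; rewrite !mxE !lift_max //.
Qed.

Lemma jacobi_trudi_widen N N' h nu r : h 0%N = 1 ->
  (size nu <= N)%N -> (size (onerow r) <= N)%N -> (N <= N')%N ->
  jacobi_trudi N' h nu r = jacobi_trudi N h nu r.
Proof.
move=> h0 le_nu le_r /subnKC <-; elim: (N' - N)%N => [|d IH]; first by rewrite addn0.
by rewrite addnS jacobi_trudiS // (leq_trans _ (leq_addr _ _)).
Qed.

Lemma skew_schur_onerow (p : nat -> K) N nu r :
  (size nu <= N)%N -> (size (onerow r) <= N)%N ->
  skew_schur p nu (onerow r) = jacobi_trudi N (hsym p) nu r.
Proof.
move=> le_nu le_r; rewrite (@jacobi_trudi_widen (maxn (size nu) (size (onerow r)))) //.
- exact: fps_exp0.
- exact: leq_maxl.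
- exact: leq_maxr.
by rewrite geq_max le_nu.
Qed.

(** The analogue of the classical alternant, with shifts of [h] in place of powers. Arbitrary [n] is
    allowed so that one formula covers both [nu] and the empty partition. *)
Definition alternant N h (n : 'I_N -> nat) : K :=
  \det (\matrix_(i < N, j < N) seqz h ((n i)%:Z - (N.-1 - j)%:Z)).

Lemma alternant_jacobi_trudi N h nu :
  jacobi_trudi N h nu 0 = alternant h (fun i : 'I_N => nth 0%N nu i + (N.-1 - i))%N.
Proof.
congr (\det _); apply/matrixP => i j; rewrite !mxE nth_nil; congr seqz.
have := ltn_ord i; have := ltn_ord j; lia.
Qed.

Lemma alternant_delta N h : h 0%N = 1 ->
  alternant h (fun i : 'I_N => (N.-1 - i)%N) = 1.
Proof.
move=> h0; rewrite /alternant -det_tr det_trig.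
  by apply: big1 => i _; rewrite !mxE subrr.
apply/is_trig_mxP => i j lt_ij; rewrite !mxE seqz_neg //.
have := ltn_ord i; have := ltn_ord j; lia.
Qed.

(** The matrix factors through the monomials. The second determinant does not involve the points
    [x], which makes the constants in [alternant_elsym] uniform in [n]. *)
Lemma det_horner N (P : 'I_N -> {poly K}) (x : 'I_N -> K) :
  (forall j, size (P j) <= N)%N ->
  \det (\matrix_(i, j) (P j).[x i]) =
  \det (Vandermonde N (\row_i x i)) * \det (\matrix_(k, j) (P j)`_k).
Proof.
move=> szP; rewrite -[\det (Vandermonde _ _)]det_tr -det_mulmx; congr (\det _).
apply/matrixP => i j; rewrite !mxE (horner_coef_wide _ (szP j)).
by apply: eq_bigr => k _; rewrite !mxE mulrC.
Qed.

End JacobiTrudi.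

(** * The conjugation identity for Schur functions at q^rho *)

Section Transpose.
Variables (K : fieldType) (s : K) (h : nat -> K).
Hypothesis s_neq0 : s != 0.
Hypothesis h0 : h 0%N = 1.
Hypothesis h_rec : forall n,
  h n.+1 * (s ^+ 2 ^+ n.+1 - 1) = s ^+ n.*2.+1 * h n.

(* The elementary symmetric functions of the alphabet with complete symmetric
   functions h; the factor is q^(- n (n - 1) / 2). *)
Definition elsym (n : nat) : K := s ^- (n * n.-1) * h n.

Lemma elsym0 : elsym 0 = 1.
Proof. by rewrite /elsym mul0n expr0 invr1 mul1r. Qed.

Lemma elsym_rec n : elsym n.+1 * (s ^+ 2 ^+ n.+1 - 1) = s * elsym n.
Proof.
rewrite /elsym -mulrA h_rec !mulrA; congr (_ * _).
have -> : (n.+1 * n.+1.-1 = n * n.-1 + n.*2)%N.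
  by case: n => // n; rewrite !succnK -muln2; ring.
by rewrite exprD exprS; field; rewrite !expf_neq0.
Qed.

(** Comes from iterating [h_rec] downwards: at [x = s ^+ n.*2], that is [q^n], the step from
    [h (n - t)] to [h (n - t - 1)] multiplies by [(s x - s ^+ t.*2.+1) / x]. *)
Definition shift_poly k : {poly K} :=
  \prod_(t < k) (s *: 'X - (s ^+ t.*2.+1)%:P).

Lemma size_shift_poly k : (size (shift_poly k) <= k.+1)%N.
Proof.
rewrite /shift_poly; elim: k => [|k IH]; first by rewrite big_ord0 size_poly1.
rewrite big_ord_recr /=; apply: leq_trans (size_polyMleq _ _) _.
have bound a b : (a <= k.+1 -> b <= 2 -> (a + b).-1 <= k.+2)%N by lia.
apply: bound => //; apply: leq_trans (size_polyD _ _) _; rewrite geq_max size_polyN.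
by rewrite (leq_trans (size_scale_leq _ _)) ?size_polyX // (leq_trans (size_polyC_leq1 _)).
Qed.

(** For [k > n] the factor [t = n] of [shift_poly] vanishes at [q^n], in agreement with the value 0
    of [seqz]. *)
Lemma seqz_shift n k :
  seqz h (n%:Z - k%:Z) = h n * (s ^+ n.*2) ^- k * (shift_poly k).[s ^+ n.*2].
Proof.
rewrite /shift_poly seqzB; elim: k => [|k IH].
  by rewrite big_ord0 expr0 invr1 mulr1 hornerC mulr1 leq0n subn0.
rewrite big_ord_recr /= hornerM hornerD hornerN hornerZ hornerX hornerC.
set P := \prod_(_ < k) _ in IH *; set x := s ^+ n.*2 in IH *.
have nzx : x != 0 by rewrite expf_neq0.
have -> : h n * x ^- k.+1 * (P.[x] * (s * x - s ^+ k.*2.+1))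
    = (h n * x ^- k * P.[x]) * ((s * x - s ^+ k.*2.+1) / x).
  by rewrite exprS; field; rewrite nzx expf_neq0.
rewrite -{}IH; case: ltnP => [lt_kn|le_nk].
  rewrite ltnW // -(subnSK lt_kn); set d := (n - k.+1)%N.
  apply: (mulIf nzx); rewrite mulrA divfK //.
  apply: (mulfI (expf_neq0 d.*2.+1 s_neq0)).
  have -> : x = s ^+ d.*2 * s ^+ k.*2 * s ^+ 2.
    by rewrite -!exprD; congr (_ ^+ _); rewrite /d; lia.
  have e2 : s ^+ 2 ^+ d.+1 = s ^+ d.*2 * s ^+ 2.
    by rewrite -exprM -exprD; congr (_ ^+ _); lia.
  rewrite [LHS]mulrA -h_rec e2 ![s ^+ _.*2.+1]exprS; ring.
case: leqP => [le_kn|]; last by rewrite mul0r.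
have -> : k = n by lia.
by rewrite exprS subrr mul0r mulr0.
Qed.

(** By [(n - k) (n - k - 1) + 2 n k = n (n - 1) + k (k + 1)], the power of [s] in [elsym] absorbs
    the [(q^n)^(- k)] of [seqz_shift]; a row factor, a column factor and the same polynomial
    remain. *)
Lemma seqz_elsym_shift n k :
  seqz elsym (n%:Z - k%:Z)
  = h n * s ^- (n * n.-1) * s ^- (k * k.+1) * (shift_poly k).[s ^+ n.*2].
Proof.
have := seqz_shift n k; rewrite !seqzB; case: leqP => [le_kn|lt_nk] e; last first.
  move/esym/eqP: e; rewrite !mulf_eq0 invr_eq0 !expf_eq0 (negPf s_neq0) !andbF orbF.
  by case/orP=> /eqP->; rewrite ?mul0r ?mulr0.
rewrite /elsym e.
have nn : ((n - k) * (n - k).-1 + n.*2 * k = n * n.-1 + k * k.+1)%N.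
  move: (n - k)%N (subnK le_kn) => d <-; rewrite -muln2.
  by case: d => [|d]; [case: (k) => // k'|]; rewrite ?addSn ?add0n ?succnK; ring.
rewrite -exprM -mulrA; rewrite !mulrA; congr (_ * _).
rewrite -(mulrC (h n)) -!mulrA; congr (_ * _); rewrite -!invfM -!exprD nn //.
Qed.

Lemma prod_exprz (I : Type) (r : seq I) (P : pred I) (f : I -> int) :
  \prod_(i <- r | P i) s ^ f i = s ^ (\sum_(i <- r | P i) f i).
Proof.
by apply/esym/(big_morph (fun m : int => s ^ m)) => // m n; rewrite expfzDr.
Qed.

(* Both alternants are, up to row factors, constant multiples of the Vandermonde
   determinant in the q^(n_i). *)
Lemma alternant_elsym N : exists c : K, forall n : 'I_N -> nat,
  alternant elsym n
  = s ^ (\sum_i ((n i)%:Z * (2%:Z * N.-1%:Z + 1 - (n i)%:Z))) * c * alternant h n.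
Proof.
(* Taking [x^(- (N - 1))] out of a row turns its [x^(- k)], with [k = N - 1 - j], into [x^j]: the
   entries become polynomials of degree less than [N]. *)
pose Q (j : 'I_N) := 'X^j * shift_poly (N.-1 - j).
have szS (j : 'I_N) : (size (shift_poly (N.-1 - j)) <= N - j)%N.
  by apply: leq_trans (size_shift_poly _) _; have := ltn_ord j; lia.
have szQ j : (size (Q j) <= N)%N.
  rewrite /Q; apply: leq_trans (size_polyMleq _ _) _; rewrite size_polyXn.
  move: (szS j) (ltn_ord j); set a := size _; lia.
have szE (j : 'I_N) : (size (shift_poly (N.-1 - j)) <= N)%N.
  exact: leq_trans (szS j) (leq_subr _ _).
pose V (n : 'I_N -> nat) := \det (Vandermonde N (\row_i (s ^+ (n i).*2))).
pose H (n : 'I_N -> nat) := \prod_i h (n i).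
have [ce Ee] : exists c : K, forall n, alternant elsym n
    = s ^ (\sum_i (n i)%:Z * (1 - (n i)%:Z)) * H n * V n * c.
  pose P (j : 'I_N) := s ^- ((N.-1 - j) * (N.-1 - j).+1) *: shift_poly (N.-1 - j).
  exists (\det (\matrix_(k, j) (P j)`_k)) => n.
  rewrite -mulrA -det_horner => [|j]; last first.
    by rewrite /P (leq_trans (size_scale_leq _ _)).
  rewrite -prod_exprz -big_split -det_mul_rows; congr (\det _).
  apply/matrixP => i j; rewrite !mxE seqz_elsym_shift hornerZ /=.
  have -> : s ^ ((n i)%:Z * (1 - (n i)%:Z)) = s ^- (n i * (n i).-1).
    rewrite exprnN; congr (_ ^ _).
    by case: (n i) => // m; rewrite succnK; lia.
  ring.
have [ch Eh] : exists c : K, forall n, alternant h n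
    = s ^ (\sum_i (- (2%:Z * (n i)%:Z * N.-1%:Z))) * H n * V n * c.
  exists (\det (\matrix_(k, j) (Q j)`_k)) => n.
  rewrite -mulrA -det_horner // -prod_exprz -big_split -det_mul_rows; congr (\det _).
  apply/matrixP => i j; rewrite !mxE seqz_shift hornerM hornerXn /=.
  have -> : s ^ (- (2%:Z * (n i)%:Z * N.-1%:Z))
      = (s ^+ (n i).*2) ^- (N.-1 - j) * (s ^+ (n i).*2) ^- j.
    rewrite -invfM -exprD -exprM exprnN; congr (_ ^ _).
    by have := ltn_ord j; nia.
  have nzx : s ^+ (n i).*2 != 0 by rewrite expf_neq0.
  by field; rewrite !expf_neq0.
pose n0 (i : 'I_N) := (N.-1 - i)%N.
(* The staircase exponents, those of the empty partition, give an alternant equal to 1. *)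
have ch_neq0 : ch != 0.
  apply: contra_eq_neq (alternant_delta N h0) => ch0.
  by rewrite Eh ch0 mulr0 eq_sym oner_neq0.
exists (ce / ch) => n; rewrite Ee Eh.
have -> : \sum_i (n i)%:Z * (2%:Z * N.-1%:Z + 1 - (n i)%:Z)
  = \sum_i (n i)%:Z * (1 - (n i)%:Z) - \sum_i (- (2%:Z * (n i)%:Z * N.-1%:Z)).
  by rewrite -sumrB; apply: eq_bigr => i _; ring.
rewrite expfzDr // -invr_expz.
by field; rewrite ch_neq0 expfz_neq0.
Qed.

(** The two sums are the exponents of [alternant_elsym] at the shifted parts and at the staircase;
    row [i], counted from 0, contributes the difference [nu_i (2 i + 1 - nu_i)]. *)
Lemma kappaE N nu : (size nu <= N)%N ->
  - kappa nu
  = \sum_(i < N) (let n := (nth 0%N nu i + (N.-1 - i))%N in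
                   n%:Z * (2%:Z * N.-1%:Z + 1 - n%:Z))
  - \sum_(i < N) (let n := (N.-1 - i)%N in n%:Z * (2%:Z * N.-1%:Z + 1 - n%:Z)).
Proof.
move=> le_N; rewrite -sumrB /kappa.
rewrite (big_ord_widen_cond _ xpredT
  (fun i => (nth 0%N nu i)%:Z * ((nth 0%N nu i)%:Z - 2%:Z * (i.+1)%:Z + 1)) le_N).
rewrite big_mkcond -sumrN; apply: eq_bigr => i _ /=.
have eN : (N.-1 - i)%N%:Z = N.-1%:Z - i%:Z by have := ltn_ord i; lia.
rewrite PoszD eN; case: ltnP => [_|le_i]; last by rewrite nth_default //; ring.
have -> : i.+1%:Z = i%:Z + 1 by lia.
ring.
Qed.

(** The classical [s_(nu^t) = q^(- kappa_nu / 2) s_nu] at [q^rho], with conjugation encoded by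
    trading [h] for [elsym]. The constant left open by [alternant_elsym] is eliminated by comparison
    with the empty partition. *)
Lemma jacobi_trudi_elsym N nu : (size nu <= N)%N ->
  jacobi_trudi N elsym nu 0 = s ^ (- kappa nu) * jacobi_trudi N h nu 0.
Proof.
move=> le_N; have [c E] := alternant_elsym N.
rewrite !alternant_jacobi_trudi E; congr (_ * _).
have := E (fun i => N.-1 - i)%N; rewrite !alternant_delta ?elsym0 // mulr1 => E1.
rewrite (kappaE le_N) expfzDr //; congr (_ * _).
by rewrite -invr_expz -[RHS]mulr1 {1}E1 mulKf // expfz_neq0.
Qed.

End Transpose.

(** * Partitions and strictly decreasing sequences *)

Section PartitionFacts.
Local Open Scope nat_scope.
Implicit Types nu : seq nat.

Lemma partition_nth_geq nu i j : is_partition nu -> i <= j -> nth 0 nu j <= nth 0 nu i.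
Proof.
case/andP=> nu_sorted _ le_ij; case: (ltnP j (size nu)) => [lt_j|le_j]; last first.
  by rewrite nth_default.
apply: (sorted_leq_nth _ _ _ nu_sorted) => //; rewrite ?inE //.
- by move=> x y z /= h1 h2; apply: leq_trans h2 h1.
- exact: leqnn.
- exact: leq_ltn_trans lt_j.
Qed.

Lemma partition_nth_gt0 nu i : is_partition nu -> i < size nu -> 0 < nth 0 nu i.
Proof.
case/andP=> _ nu0 lt_i; rewrite lt0n; apply: contraNneq nu0 => <-.
exact: mem_nth.
Qed.

Lemma partition_eq nu nu' : is_partition nu -> is_partition nu' ->
  (forall i, nth 0 nu i = nth 0 nu' i) -> nu = nu'.
Proof.
have le_size mu mu' : is_partition mu' -> nth 0 mu =1 nth 0 mu' -> size mu' <= size mu.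
  move=> Pmu' e; rewrite leqNgt; apply/negP => /(partition_nth_gt0 Pmu').
  by rewrite -e nth_default.
move=> Pnu Pnu' e; apply: (@eq_from_nth _ 0) => //.
by apply/eqP; rewrite eqn_leq !le_size // => i; rewrite e.
Qed.

Lemma sumn_nth N nu : size nu <= N -> sumn nu = \sum_(i < N) nth 0 nu i.
Proof.
move=> le_N; rewrite sumnE (big_nth 0) big_mkord.
rewrite (big_ord_widen _ (nth 0 nu) le_N) [RHS](bigID (fun i : 'I_N => i < size nu)) /=.
by rewrite [X in _ + X]big1 ?addn0 // => i; rewrite -leqNgt => /(nth_default 0).
Qed.

Lemma leq_size_sumn nu : is_partition nu -> size nu <= sumn nu.
Proof.
case/andP=> _; elim: nu => //= x nu IH; rewrite inE negb_or eq_sym -lt0n.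
by case/andP=> x_gt0 /IH; lia.
Qed.

Lemma nth_filter_pos (s : seq nat) i : sorted geq s ->
  nth 0 [seq x <- s | 0 < x] i = nth 0 s i.
Proof.
elim: s i => //= x s IH i; rewrite path_sortedE; last first.
  by move=> a b c /= h1 h2; apply: leq_trans h2 h1.
case/andP=> /allP le_x s_sorted; case: posnP => [x0|x_gt0]; last first.
  by case: i => //= i; apply: IH.
have s0 y : y \in s -> y = 0 by move/le_x => /=; lia.
rewrite (@eq_in_filter _ _ pred0) ?filter_pred0 => [|y /s0->//].
rewrite nth_nil x0; case: i => //= i.
by case: (ltnP i (size s)) => [/(mem_nth 0)/s0|/(nth_default 0)] ->.
Qed.

(** Adding the staircase makes the parts strictly decreasing, so partitions with at most [N] parts
    become [N]-element sets of indices, as Cauchy-Binet requires. *)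
Definition shifted_parts N nu (i : 'I_N) := nth 0 nu i + (N.-1 - i).

Lemma shifted_parts_lt N nu (i j : 'I_N) : is_partition nu -> i < j ->
  shifted_parts nu j < shifted_parts nu i.
Proof.
move=> Pnu lt_ij; have := partition_nth_geq Pnu (ltnW lt_ij).
rewrite /shifted_parts; have := ltn_ord j; lia.
Qed.

Lemma shifted_parts_inj N nu : is_partition nu -> injective (@shifted_parts N nu).
Proof.
move=> Pnu i j e; apply/val_inj/eqP.
by case: ltngtP => // /(shifted_parts_lt Pnu); rewrite e ltnn.
Qed.

Lemma sum_shifted_parts N nu : size nu <= N ->
  \sum_(i < N) shifted_parts nu i = sumn nu + \sum_(i < N) (N.-1 - i).
Proof. by move=> le_N; rewrite big_split -sumn_nth. Qed.

(** The set of values determines its decreasing enumeration, hence [nu]; then [t] is determined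
    because the values are distinct. *)
Lemma shifted_parts_perm_inj N nu nu' (t t' : 'S_N) :
  is_partition nu -> is_partition nu' -> size nu <= N -> size nu' <= N ->
  (forall i, shifted_parts nu (t i) = shifted_parts nu' (t' i)) ->
  nu = nu' /\ t = t'.
Proof.
move=> Pnu Pnu' le_nu le_nu' e.
have sorted_sh mu : is_partition mu -> sorted gtn (map (@shifted_parts N mu) (enum 'I_N)).
  move=> Pmu; rewrite sorted_map; have := iota_ltn_sorted 0 N.
  rewrite -val_enum_ord sorted_map; apply: sub_sorted => i j /=.
  exact: shifted_parts_lt.
have eq_sh : map (@shifted_parts N nu) (enum 'I_N) = map (@shifted_parts N nu') (enum 'I_N).
  apply: (irr_sorted_eq (leT := gtn)); rewrite ?sorted_sh //.
  - by move=> x y z /= h1 h2; apply: ltn_trans h2 h1.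
  - by move=> x /=; rewrite ltnn.
  move=> x; apply/mapP/mapP => -[i _ ->].
    by exists (t' (t^-1%g i)); rewrite ?mem_enum // -e permKV.
  by exists (t (t'^-1%g i)); rewrite ?mem_enum // e permKV.
have eq_shi (i : 'I_N) : shifted_parts nu i = shifted_parts nu' i.
  by move/eq_in_map: eq_sh => h; apply: h; rewrite mem_enum.
have enu : nu = nu'.
  apply: partition_eq => // i; case: (ltnP i N) => [lt_i|le_i].
    by have := eq_shi (Ordinal lt_i); rewrite /shifted_parts /=; lia.
  by rewrite !nth_default // (leq_trans _ le_i).
split=> //; apply/permP => i; apply: (shifted_parts_inj Pnu).
by rewrite e enu.
Qed.

Lemma shifted_parts_surj N m (f : {ffun 'I_N -> nat}) : injective f ->
  \sum_i f i = m + \sum_(i < N) (N.-1 - i) ->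
  exists nu (t : 'S_N), nu \in partitions m /\ f = [ffun i => shifted_parts nu (t i)].
Proof.
move=> f_inj f_sum.
pose s := sort geq (map f (enum 'I_N)).
have sz_s : size s = N by rewrite size_sort size_map size_enum_ord.
have s_uniq : uniq s by rewrite sort_uniq map_inj_uniq ?enum_uniq.
have s_geq : sorted geq s by apply: sort_sorted => x y; apply: leq_total.
have s_gtn i j : i < j -> j < N -> nth 0 s j < nth 0 s i.
  move=> lt_ij lt_j; rewrite ltn_neqAle nth_uniq ?sz_s //; last exact: ltn_trans lt_j.
  rewrite neq_ltn lt_ij orbT; apply: (sorted_leq_nth _ _ _ s_geq); rewrite ?inE ?sz_s //.
  - by move=> x y z /= h1 h2; apply: leq_trans h2 h1.
  - exact: leqnn.
  - exact: ltn_trans lt_j.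
  exact: ltnW.
(* Entry [i] has [N.-1 - i] strictly smaller naturals after it. This makes the truncated subtraction
   in [mu] exact. *)
have s_ge i : i < N -> N.-1 - i <= nth 0 s i.
  move=> lt_i; move: {2}(N.-1 - i) (erefl (N.-1 - i)) => k.
  elim: k i lt_i => [|k IH] i lt_i ek; first by rewrite ek.
  have lt_i1 : i.+1 < N by lia.
  have := IH _ lt_i1 ltac:(lia); have := s_gtn _ _ (ltnSn i) lt_i1; lia.
pose mu := mkseq (fun i => nth 0 s i - (N.-1 - i)) N.
have mu_geq : sorted geq mu.
  apply/(sortedP 0) => i; rewrite size_mkseq => lt_i.
  rewrite !nth_mkseq //=; last by lia.
  have := s_gtn _ _ (ltnSn i) lt_i; lia.
(* Zero parts are dropped to satisfy [is_partition]; [nth] with default 0 does not see the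
   difference. *)
pose nu := [seq x <- mu | 0 < x].
have nth_nu (i : 'I_N) : nth 0 nu i = nth 0 s i - (N.-1 - i).
  by rewrite nth_filter_pos // nth_mkseq.
have sh_nu (i : 'I_N) : shifted_parts nu i = nth 0 s i.
  by rewrite /shifted_parts nth_nu subnK ?s_ge.
have Pnu : is_partition nu.
  rewrite /is_partition mem_filter ltnn andbT.
  by apply: sorted_filter mu_geq => x y z /= h1 h2; apply: leq_trans h2 h1.
have sz_nu : size nu <= N by rewrite size_filter (leq_trans (count_size _ _)) ?size_mkseq.
have lt_idx i : index (f i) s < N.
  by rewrite -[X in _ < X]sz_s index_mem mem_sort map_f ?mem_enum.
have t_inj : injective (fun i => Ordinal (lt_idx i)).
  move=> i j /(congr1 val) /= e; apply: f_inj.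
  have fs k : f k \in s by rewrite mem_sort map_f ?mem_enum.
  by rewrite -(nth_index 0 (fs i)) e nth_index.
exists nu, (perm t_inj).
have ef : f = [ffun i => shifted_parts nu (perm t_inj i)].
  apply/ffunP => i; rewrite ffunE sh_nu permE /= nth_index //.
  by rewrite mem_sort map_f ?mem_enum.
split=> //; rewrite mem_partitions Pnu.
apply/eqP/(@addIn (\sum_(i < N) (N.-1 - i))); rewrite -f_sum -sum_shifted_parts //.
rewrite (reindex_inj (@perm_inj _ (perm t_inj))); apply: eq_bigr => i _.
by rewrite [in RHS]ef ffunE.
Qed.

End PartitionFacts.

(** * The Schur pairing *)

Section CauchyBinet.
Variables (K : fieldType).

Lemma coefs_prod N (f : 'I_N -> {fps K}) p :
  coefs (\prod_j f j) p =
  \sum_(n : {ffun 'I_N -> 'I_p.+1} | (\sum_j n j == p)%N) \prod_j coefs (f j) (n j).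
Proof.
have -> : coefs (\prod_j f j) p = (\prod_j \poly_(i < p.+1) coefs (f j) i)`_p.
  pose R (u : {fps K}) (v : {poly K}) := forall k, (k <= p)%N -> coefs u k = v`_k.
  suff : R (\prod_j f j) (\prod_j \poly_(i < p.+1) coefs (f j) i) by exact.
  apply: big_ind2 => [k _|u v u' v' Ru Ru' k le_kp|j _ k le_kp].
  - by rewrite coefs1 coef1.
  - rewrite coefsM coefM; apply: eq_bigr => i _.
    by rewrite Ru ?Ru' //; have := ltn_ord i; lia.
  - by rewrite coef_poly ltnS le_kp.
under eq_bigr => j _ do rewrite poly_def.
rewrite bigA_distr_bigA coef_sum [RHS]big_mkcond; apply: eq_bigr => n _ /=.
have -> : \prod_j (coefs (f j) (n j) *: 'X^(n j))
    = (\prod_j coefs (f j) (n j)) *: 'X^(\sum_j n j) :> {poly K}.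
  by rewrite scaler_prod; congr (_ *: _); rewrite expr_sum.
by rewrite coefZ coefXn eq_sym; case: eqP; rewrite ?mulr1 ?mulr0.
Qed.

Lemma size_partitions m nu : nu \in partitions m -> (size nu <= m)%N.
Proof. by rewrite mem_partitions => /andP[/leq_size_sumn le_nu /eqP <-]. Qed.

(** An injective sequence is a rearranged strictly decreasing one. The bound [Q] exceeds the
    prescribed sum, hence every value, and keeps the index type finite. *)
Lemma sum_injective_ffun N m Q (G : {ffun 'I_N -> nat} -> K) :
  (m <= N)%N -> (m + \sum_(i < N) (N.-1 - i) < Q)%N ->
  \sum_(n : {ffun 'I_N -> 'I_Q} |
          injectiveb n && (\sum_i n i == m + \sum_(i < N) (N.-1 - i))%N)
     G [ffun i => val (n i)]
  = \sum_(nu <- partitions m) \sum_(t : 'S_N) G [ffun i => shifted_parts nu (t i)].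
Proof.
move=> le_mN lt_Q; set P := (X in \sum_(n | X n) _).
pose L' := [seq [ffun i => val (n i)] | n : {ffun 'I_N -> 'I_Q} <- enum P]
  : seq {ffun 'I_N -> nat}.
pose L := [seq [ffun i => shifted_parts nu (t i)] |
    nu <- partitions m, t : {perm 'I_N} <- enum {: 'S_N}]
  : seq {ffun 'I_N -> nat}.
have part_m nu : nu \in partitions m -> [/\ is_partition nu, size nu <= N & sumn nu = m]%N.
  move=> nu_m; have := nu_m; rewrite mem_partitions => /andP[Pnu /eqP num].
  by split=> //; apply: leq_trans le_mN; apply: size_partitions.
have -> : \sum_(n | P n) G [ffun i => val (n i)] = \sum_(f <- L') G f.
  by rewrite big_map big_enum.
have -> : \sum_(nu <- partitions m) \sum_(t : 'S_N) G [ffun i => shifted_parts nu (t i)]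
    = \sum_(f <- L) G f.
  rewrite big_allpairs_dep; apply: eq_bigr => nu _; rewrite big_enum.
  by apply: eq_bigl => t; rewrite inE.
apply: perm_big; apply: uniq_perm.
- rewrite map_inj_uniq ?enum_uniq // => n n' /ffunP e; apply/ffunP => i.
  by apply: val_inj; have := e i; rewrite !ffunE.
- apply: allpairs_uniq; rewrite ?partitions_uniq ?enum_uniq //.
  move=> [nu t] [nu' t'] /allpairsP[[x y] /= [xm _ [-> ->]]].
  case/allpairsP=> [[x' y'] /= [xm' _ [-> ->]]].
  have [Px sx _] := part_m _ xm; have [Px' sx' _] := part_m _ xm'.
  move/ffunP => e; have [] := @shifted_parts_perm_inj N x x' y y' Px Px' sx sx'.
    by move=> i; have := e i; rewrite !ffunE.
  by move=> -> ->.
move=> f; apply/mapP/allpairsP => [[n]|[[nu t] /= [nu_m _ ->]]].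
  rewrite mem_enum => /andP[/injectiveP n_inj /eqP n_sum] ->.
  have [||nu [t [nu_m ->]]] := @shifted_parts_surj N m [ffun i => val (n i)].
  - by move=> i j; rewrite !ffunE => /val_inj/n_inj.
  - by rewrite -n_sum; apply: eq_bigr => i _; rewrite ffunE.
  by exists (nu, t); rewrite mem_enum inE.
have [Pnu sz_nu sum_nu] := part_m _ nu_m.
have sum_f : (\sum_i shifted_parts nu (t i) = m + \sum_(i < N) (N.-1 - i))%N.
  by rewrite -sum_nu -sum_shifted_parts // [RHS](reindex_inj (@perm_inj _ t)).
have lt_f i : (shifted_parts nu (t i) < Q)%N.
  by apply: leq_ltn_trans lt_Q; rewrite -sum_f (bigD1 i) //= leq_addr.
exists [ffun i => Ordinal (lt_f i)]; last by apply/ffunP => i; rewrite !ffunE.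
rewrite mem_enum; apply/andP; split.
  by apply/injectiveP => i j; rewrite !ffunE => -[] /(shifted_parts_inj Pnu)/perm_inj.
by rewrite -sum_f; apply/eqP/eq_bigr => i _; rewrite ffunE.
Qed.

(** Cauchy-Binet for infinitely many indices, made finite by a grading: the power of the variable
    records the sum of the chosen indices. Repeated indices give equal rows, and the other choices
    are sorted into [nu] plus the staircase. *)
Lemma cauchy_binet N m (a b : 'I_N -> nat -> K) : (m <= N)%N ->
  coefs (\det (\matrix_(j, j') \fps_n (a j n * b j' n))) (m + \sum_(i < N) (N.-1 - i))
  = \sum_(nu <- partitions m)
      \det (\matrix_(i, j) a j (shifted_parts nu i)) *
      \det (\matrix_(i, j) b j (shifted_parts nu i)).
Proof.
move=> le_mN; set p := (m + _)%N.
pose G (n : {ffun 'I_N -> nat}) :=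
  (\prod_j a j (n j)) * \det (\matrix_(i, j) b j (n i)).
transitivity (\sum_(n : {ffun 'I_N -> 'I_p.+1} | (\sum_j n j == p)%N) G [ffun i => val (n i)]).
  rewrite coefs_sum.
  under eq_bigr => s _.
    rewrite -signr_odd; have -> : (-1) ^+ odd s = fps_const ((-1) ^+ odd s) :> {fps K}.
      by case: odd; apply: fpsP => -[|n] //=; rewrite ?oppr0.
    rewrite coefs_constM coefs_prod mulr_sumr; over.
  rewrite exchange_big; apply: eq_bigr => n _; rewrite /G mulr_sumr.
  apply: eq_bigr => s _; rewrite signr_odd mulrCA; congr (_ * _).
  by rewrite -big_split; apply: eq_bigr => j _; rewrite !mxE !ffunE.
rewrite (bigID (fun n : {ffun _} => injectiveb n)) /= [X in _ + X]big1 ?addr0; last first.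
  move=> n /andP[_ /injectivePn[i [i' neq_ii' e]]].
  rewrite /G (determinant_alternate neq_ii') ?mulr0 // => j.
  by rewrite !mxE !ffunE e.
under eq_bigl => n do rewrite andbC.
rewrite sum_injective_ffun //; apply: eq_bigr => nu _.
rewrite -[\det (\matrix_(i, j) a _ _)]det_tr mulr_suml.
apply: eq_bigr => t _; rewrite /G.
have -> : \matrix_(i, j) b j ([ffun i => shifted_parts nu (t i)] i)
    = row_perm t (\matrix_(i, j) b j (shifted_parts nu i)) :> 'M_N.
  by apply/matrixP => i j; rewrite !mxE ffunE.
rewrite row_permE det_mulmx det_perm mulrCA mulrA; congr (_ * _ * _).
by apply: eq_bigr => j _; rewrite !mxE ffunE.
Qed.

End CauchyBinet.

(** * Adjointness through Toeplitz determinants *)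

Section SchurPairing.
Variables (K : fieldType) (e h : nat -> K).
Hypotheses (e0 : e 0%N = 1) (h0 : h 0%N = 1).

Let E : {fps K} := \fps_n e n.

(* The Laurent coefficient of z^d in (sum_n e_n (T/z)^n) (sum_n h_n z^n). *)
Let c (d : int) : {fps K} := \fps_n (e n * seqz h (n%:Z + d)).

Lemma elem_series_unit : E \is a GRing.unit.
Proof. by rewrite fps_unitE /= e0 unitr1. Qed.

Let trunc_e r : {fps K} := \fps_n (if (n <= r)%N then e n else 0).
Let g r : {fps K} := trunc_e r / E.

Lemma quot_mul r n :
  \sum_(i < n.+1) coefs (g r) i * e (n - i) = if (n <= r)%N then e n else 0.
Proof.
have /(congr1 (fun u => coefs u n)) : g r * E = trunc_e r by rewrite divrK // elem_series_unit.
by [].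
Qed.

(** [E] and its truncation agree up to degree [r], so their quotient is 1 up to that degree. *)
Lemma quot_low r n : (n <= r)%N -> coefs (g r) n = (n == 0%N)%:R.
Proof.
move: (g r) (quot_mul r) => u gE; elim/ltn_ind: n => n IH le_nr.
have := gE n; rewrite le_nr big_ord_recr subnn e0 mulr1.
case: n => [|n] in IH le_nr *; first by rewrite big_ord0 e0 /= add0r.
rewrite big_ord_recl IH // mul1r subn0 big1 ?addr0 => [|i _]; last first.
  by rewrite IH ?mul0r // /lift /bump /=; have := ltn_ord i; lia.
by rewrite /= addr0 => eu; apply: (addrI (e n.+1)); rewrite eu addr0.
Qed.

(* Dividing by E(T/z) turns the Toeplitz matrix of c into a matrix of h's. *)
Lemma toeplitz_relation r (d : int) M m : (m <= M)%N ->
  coefs (\sum_(t < M.+1) fps_const (coefs (g r) t) * (fps_X ^+ t * c (d + t%:Z))) m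
  = (if (m <= r)%N then e m else 0) * seqz h (m%:Z + d).
Proof.
move=> le_mM.
rewrite -quot_mul.
rewrite coefs_sum mulr_suml.
rewrite [RHS](big_ord_widen M.+1 (fun t => coefs (g r) t * e (m - t) * seqz h (m%:Z + d))) //.
rewrite [RHS]big_mkcond; apply: eq_bigr => t _.
rewrite coefs_constM coefs_XnM ltnS; case: leqP => [le_tm|]; last by rewrite mulr0.
rewrite /= mulrA; congr (_ * seqz h _); lia.
Qed.

(** The index of [h] forces [i >= r + j] and the truncation forces [i <= r]; only [e r * h 0]
    survives. *)
Lemma toeplitz_relation_neg r j M i : (i <= M)%N ->
  coefs (\sum_(t < M.+1) fps_const (coefs (g r) t) *
           (fps_X ^+ t * c (- r%:Z - j%:Z + t%:Z))) i
  = if (i == r) && (j == 0%N) then e r else 0.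
Proof.
move=> le_im; rewrite toeplitz_relation // {le_im}.
case: (ltngtP i r) => [lt_ir|_|->]; rewrite ?mul0r //=.
  by rewrite seqz_neg ?mulr0 //; lia.
case: j => [|j]; last by rewrite seqz_neg ?mulr0 //; lia.
have -> : r%:Z + (- r%:Z - 0%N%:Z) = 0%:Z by lia.
by rewrite /= h0 mulr1.
Qed.

(** Laplace expansion modulo degree [m + 1], where the first column is [x T^r] times the first unit
    vector. *)
Lemma coefs_det_col0 N (B : 'M[{fps K}]_N.+1) x r m :
  (forall j i, (i <= m)%N ->
     coefs (B j ord0) i = if (i == r) && (j == ord0) then x else 0) ->
  coefs (\det B) m
  = if (r <= m)%N then x * coefs (cofactor B ord0 ord0) (m - r) else 0.
Proof.
move=> col0; rewrite (expand_det_col _ ord0) big_ord_recl coefsD coefs_sum.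
rewrite [X in _ + X]big1 ?addr0 => [|j _]; last first.
  rewrite coefsM big1 // => i _; rewrite col0 -1?ltnS //.
  by rewrite andbF mul0r.
move: (cofactor _ _ _) => w.
rewrite coefsM; case: leqP => [le_rm|lt_mr]; last first.
  rewrite big1 // => i _; rewrite col0 -1?ltnS // andbT ltn_eqF ?mul0r //.
  by have := ltn_ord i; lia.
have lt_r : (r < m.+1)%N by [].
rewrite (bigD1 (Ordinal lt_r)) //= col0 // !eqxx.
rewrite big1 ?addr0 // => i; rewrite -val_eqE /= => neq_ir.
by rewrite col0 -1?ltnS // (negPf neq_ir) !mul0r.
Qed.

Let D N r := \det (\matrix_(j < N, j' < N)
  c (j'%:Z - (nth 0%N (onerow r) j')%:Z - j%:Z)).

(** Only column 0 depends on [r], so its cofactor [w] serves for all [r]. The bound on [m] reflects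
    that the [N] remaining columns realize [g r] up to degree [N + r]. *)
Lemma toeplitz_expand N : exists w : {fps K}, forall r m, (m <= N + r)%N ->
  coefs (D N.+1 r) m = if (r <= m)%N then e r * coefs w (m - r) else 0.
Proof.
pose A r : 'M[{fps K}]_N.+1 := \matrix_(j, j')
  c (j'%:Z - (nth 0%N (onerow r) j')%:Z - j%:Z).
exists (cofactor (A 0%N) ord0 ord0) => r m le_m.
(* Column [k >= 1] differs in index by [r + k] from the shifted column 0, so it is weighted by the
   term of degree [r + k] of [g r]. *)
pose U : 'M[{fps K}]_N.+1 := \matrix_(k, j')
  if j' == ord0 then fps_const (coefs (g r) (if k == ord0 then 0 else r + k)%N) *
                     fps_X ^+ (if k == ord0 then 0 else r + k)%N
  else (k == j')%:R.
have detU : \det U = 1.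
  rewrite det_trig; last first.
    apply/is_trig_mxP => k j' lt_kj; rewrite mxE.
    by case: eqP => [ej|_]; [rewrite ej in lt_kj | rewrite -val_eqE ltn_eqF].
  apply: big1 => k _; rewrite mxE eqxx; case: eqP => // _.
  by rewrite quot_low // mulr1.
have AU j j' : (A r *m U) j j' =
    if j' == ord0 then
      \sum_(t < (N + r).+1) fps_const (coefs (g r) t) * (fps_X ^+ t * c (- r%:Z - j%:Z + t%:Z))
    else A 0%N j j'.
  rewrite mxE; case: (altP (j' =P ord0)) => [->|nz_j'].
    pose F t := fps_const (coefs (g r) t) * (fps_X ^+ t * c (- r%:Z - j%:Z + t%:Z)).
    rewrite -(big_mkord predT F) big_ord_recl !mxE /= big_nat_recl //.
    rewrite nth_onerow /= [in RHS]addnC (@big_cat_nat _ _ _ r) ?leq_addr //=.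
    have -> : \sum_(0 <= t < r) F t.+1 = 0.
      apply: big1_seq => t; rewrite mem_index_iota => /andP[_ /andP[_ lt_t]].
      rewrite /F quot_low //.
      have -> : fps_const (t.+1 == 0%N)%:R = 0 :> {fps K} by apply: fpsP => -[].
      by rewrite mul0r.
    have -> : \sum_(r <= t < r + N) F t.+1 = \sum_(0 + r <= t < r + N) F t.+1 by [].
    rewrite big_addn addKn big_mkord /F; congr (_ + _).
      rewrite mulrC !mulrA; congr (_ * c _); lia.
    rewrite add0r; apply: eq_bigr => k _; rewrite !mxE nth_onerow !lift0 eqxx.
    have -> : (lift ord0 k == ord0) = false by [].
    rewrite mulrC.
    have -> : (k + r).+1 = (r + k.+1)%N by lia.
    rewrite -!mulrA; congr (_ * (_ * c _)); rewrite /=; lia.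
  rewrite (bigD1 j') //= big1 ?addr0 => [|k neq_k]; last first.
    by rewrite !mxE (negPf nz_j') (negPf neq_k) mulr0.
  rewrite !mxE (negPf nz_j') eqxx mulr1 !nth_onerow.
  by have /negPf -> : val j' != 0%N by [].
have -> : D N.+1 r = \det (A r *m U) by rewrite det_mulmx detU mulr1.
move: (A r *m U) AU => B BE {U detU}.
have cofB : cofactor B ord0 ord0 = cofactor (A 0%N) ord0 ord0.
  congr (_ * \det _); apply/matrixP => i j.
  by rewrite [LHS]mxE [LHS]mxE BE [RHS]mxE [RHS]mxE.
rewrite -cofB; apply: coefs_det_col0 => j i le_im.
by rewrite BE eqxx (toeplitz_relation_neg _ _ (leq_trans le_im le_m)).
Qed.

(** As [e 0 = 1], the case [r = 0] of [toeplitz_expand] identifies the common cofactor with [D N 0]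
    in the degrees concerned. *)
Lemma toeplitz_shift N r m : (0 < N)%N -> (m <= N)%N ->
  coefs (D N r) m = if (r <= m)%N then e r * coefs (D N 0) (m - r) else 0.
Proof.
case: N => // N _ le_m; case: r => [|r]; first by rewrite e0 mul1r subn0.
have [w Ew] := toeplitz_expand N.
rewrite Ew; last by lia.
by case: leqP => // le_rm; rewrite Ew ?e0 ?mul1r ?subn0 //; lia.
Qed.

Lemma schur_pairing N r m : (0 < N)%N -> (m <= N)%N ->
  \sum_(nu <- partitions m) jacobi_trudi N e nu 0 * jacobi_trudi N h nu r
  = if (r <= m)%N then
      e r * \sum_(nu <- partitions (m - r)) jacobi_trudi N e nu 0 * jacobi_trudi N h nu 0
    else 0.
Proof.
have sumE r' m' : (m' <= N)%N ->
    \sum_(nu <- partitions m') jacobi_trudi N e nu 0 * jacobi_trudi N h nu r'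
    = coefs (D N r') m'.
  move=> le_m'.
  pose a (j : 'I_N) (n : nat) := seqz e (n%:Z - (N.-1 - j)%:Z).
  pose b (j : 'I_N) (n : nat) := seqz h (n%:Z - (N.-1 - j)%:Z - (nth 0%N (onerow r') j)%:Z).
  transitivity (coefs (\det (\matrix_(j, j') \fps_n (a j n * b j' n)))
                  (m' + \sum_(i < N) (N.-1 - i))).
    rewrite cauchy_binet //; apply: eq_bigr => nu _.
    rewrite /jacobi_trudi; congr (_ * _); congr (\det _);
      apply/matrixP => i j; rewrite !mxE ?nth_nil; congr seqz;
      rewrite /shifted_parts; have := ltn_ord i; have := ltn_ord j; lia.
  (* The staircase raises the degree of row [j] by [N.-1 - j]; taken out of all rows, these powers
     account for the offset in [cauchy_binet]. *)
  have -> : \matrix_(j, j') \fps_n (a j n * b j' n)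
      = \matrix_(j < N, j' < N) (fps_X ^+ (N.-1 - j) *
          (\matrix_(j, j') c (j'%:Z - (nth 0%N (onerow r') j')%:Z - j%:Z)) j j').
    apply/matrixP => j j'; rewrite !mxE; apply: fpsP => n; rewrite coefs_XnM /= /a seqzB.
    case: leqP => [le_n|_]; last by rewrite mul0r.
    congr (_ * seqz h _); have := ltn_ord j; have := ltn_ord j'; lia.
  by rewrite det_mul_rows -expr_sum coefs_XnM leq_addl addnK.
move=> N_gt0 le_mN; rewrite sumE // toeplitz_shift //; case: ifP => // le_rm.
by rewrite sumE // (leq_trans (leq_subr _ _)).
Qed.

End SchurPairing.

(** * Specht modules and cycle types *)

Section InvariantTrace.
Variables (C : fieldType) (gT : finGroupType) (G : {group gT}).

Definition group_sum n (rG : mx_representation C G n) : 'M[C]_n := \sum_(g in G) rG g.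

Lemma repr_mul_group_sum n (rG : mx_representation C G n) x : x \in G ->
  rG x *m group_sum rG = group_sum rG.
Proof.
move=> Gx; rewrite /group_sum mulmx_sumr [RHS](reindex_inj (mulgI x)).
by apply: eq_big => g; rewrite ?groupMl // => Gg; rewrite repr_mxM.
Qed.

(** The kernel of the group sum is a submodule; it contains [u], hence the whole cyclic module, on
    which the group sum acts as 0. *)
Lemma trace_submod_sum0 n (rG : mx_representation C G n) u :
  u *m group_sum rG = 0 ->
  \sum_(g in G) \tr (submod_repr (cyclic_mx_module rG u) g) = 0.
Proof.
move=> u0; set U := cyclic_mx rG u.
have sub_ker : (U <= kermx (group_sum rG))%MS.
  apply: cyclic_mx_sub; last exact/sub_kermxP.
  apply/mxmoduleP => x Gx; apply/sub_kermxP.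
  by rewrite -mulmxA repr_mul_group_sum // mulmx_ker.
rewrite -raddf_sum -[\sum_(g in G) _]/(\sum_(g in G) in_submod U (val_submod 1%:M *m rG g)).
rewrite -linear_sum -mulmx_sumr.
have /sub_kermxP -> : (val_submod (1%:M : 'M_(\rank U)) <= kermx (group_sum rG))%MS.
  exact: submx_trans (val_submodP _) sub_ker.
by rewrite linear0 raddf0.
Qed.

Lemma trace_submod_fixed n (rG : mx_representation C G n) u :
  u != 0 -> (forall g, g \in G -> u *m rG g = u) ->
  forall g, g \in G -> \tr (submod_repr (cyclic_mx_module rG u) g) = 1.
Proof.
move=> nzu fix_u g Gg; set U := cyclic_mx rG u.
have fix_U : (U <= rfix_mx rG G)%MS.
  by apply: cyclic_mx_sub; [apply: rfix_mx_module | apply/rfix_mxP].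
rewrite -[submod_repr _ g]/(in_submod U (val_submod 1%:M *m rG g)).
have /rfix_mxP/(_ g Gg) -> : (val_submod (1%:M : 'M_(\rank U)) <= rfix_mx rG G)%MS.
  exact: submx_trans (val_submodP _) fix_U.
rewrite val_submodK mxtrace1.
suff -> : \rank U = 1%N by [].
have -> : (\rank U = \rank u)%N; last by rewrite rank_rV nzu.
apply/eqP; rewrite eqn_leq !mxrankS ?cyclic_mx_id //.
apply: cyclic_mx_sub => //; apply/mxmoduleP => x Gx; rewrite fix_u //.
Qed.

End InvariantTrace.

Section Specht.
Variable C : numFieldType.

Section YoungSymmetrizer.
Variable mu : seq nat.
Hypothesis Pmu : is_partition mu.
Let n := sumn mu.
Let G : {group 'S_n} := [set: 'S_n]%G.

Let delta (g : 'S_n) : 'rV[C]_#|G| := delta_mx 0 (gring_index G g).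

Lemma delta_regular g x : delta g *m regular_repr C G x = delta (g * x)%g.
Proof. by rewrite -rowE rowK gring_indexK ?inE. Qed.

Lemma delta_group_sum g :
  delta g *m group_sum (regular_repr C G) = \sum_(x in G) delta x.
Proof.
rewrite mulmx_sumr [RHS](reindex_inj (mulgI g)).
by apply: eq_big => x; rewrite ?inE // => _; rewrite delta_regular.
Qed.

(** Multiplication by the group sum forgets the group element, so only signs over the column
    stabilizer are summed. The first boxes of the first two rows share a column; translation by
    their transposition pairs opposite signs. *)
Lemma young_group_sum : (1 < size mu)%N ->
  young_symmetrizer C mu *m group_sum (regular_repr C G) = 0.
Proof.
move=> mu_gt1; rewrite mulmx_suml big1 // => r _.
rewrite mulmx_suml.
under eq_bigr => c _ do rewrite -scalemxAl delta_group_sum.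
rewrite -scaler_suml; apply/eqP; rewrite scaler_eq0; apply/orP; left; apply/eqP.
have [m0_gt0 m1_gt0] : (0 < nth 0 mu 0)%N /\ (0 < nth 0 mu 1)%N.
  by split; apply: partition_nth_gt0 => //; apply: leq_trans mu_gt1.
have lt0 : (flatten_index mu 0 0 < n)%N by apply: flatten_indexP.
have lt1 : (flatten_index mu 1 0 < n)%N by apply: flatten_indexP.
pose t := tperm (Ordinal lt0) (Ordinal lt1).
have t_off k : reshape_offset mu (t k) = reshape_offset mu k.
  by rewrite /t; case: tpermP => // ->; rewrite !flatten_indexKr.
have odd_t : odd_perm t.
  rewrite odd_tperm; apply/eqP => /(congr1 (fun k : 'I_n => reshape_index mu k)).
  by rewrite !flatten_indexKl.
set S := \sum_(c in _) _.
suff SN : S = - S.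
  have : S *+ 2 == 0 by rewrite mulr2n {1}SN addNr.
  by rewrite mulrn_eq0 => /eqP.
rewrite {1}/S (reindex_inj (mulgI t)) -sumrN; apply: eq_big => c.
  rewrite !inE; apply/forallP/forallP => h k.
    by have := h (t k); rewrite permM tpermK t_off.
  by rewrite permM (eqP (h _)) t_off.
by move=> _; rewrite odd_permM odd_t signr_addb /= expr1 mulN1r.
Qed.

Lemma young_onerow : (size mu <= 1)%N ->
  young_symmetrizer C mu = \sum_(x in G) delta x.
Proof.
move=> mu_le1.
have idx0 (k : 'I_n) : reshape_index mu k = 0%N.
  by have := reshape_indexP (ltn_ord k); lia.
have rowT : row_stab mu = G.
  by apply/setP => s; rewrite !inE; apply/forallP => k; rewrite !idx0.
have col1 : col_stab mu = [set 1%g].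
  apply/setP => s; rewrite !inE; apply/forallP/eqP => [h|-> k]; last by rewrite perm1.
  apply/permP => k; rewrite perm1; apply/val_inj/eqP; have := h k.
  by rewrite /reshape_offset !idx0 take0 !subn0.
rewrite /young_symmetrizer rowT col1; apply: eq_bigr => r _.
by rewrite big_set1 odd_perm1 scale1r mulg1.
Qed.

Lemma young_onerow_neq0 : \sum_(x in G) delta x != 0.
Proof.
apply/eqP => /matrixP/(_ ord0 (gring_index G 1%g)); rewrite summxE (bigD1 1%g) ?inE //=.
rewrite !mxE !eqxx big1 ?addr0 => [/eqP|x /andP[_ neq_x1]]; first by rewrite oner_eq0.
rewrite mxE eqxx /= (can_in_eq (gring_indexK (G := G))) ?inE //.
by rewrite eq_sym (negPf neq_x1).
Qed.

Lemma young_onerow_fixed x : (\sum_(y in G) delta y) *m regular_repr C G x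
  = \sum_(y in G) delta y.
Proof.
rewrite mulmx_suml [RHS](reindex_inj (mulIg x)).
by apply: eq_big => y; rewrite ?inE // => _; rewrite delta_regular.
Qed.

Lemma sum_trace_specht :
  \sum_(s : 'S_n) \tr (specht_repr C mu s) = if (size mu <= 1)%N then n`!%:R else 0.
Proof.
have -> : \sum_(s : 'S_n) \tr (specht_repr C mu s)
    = \sum_(s in G) \tr (specht_repr C mu s) by apply: eq_bigl => s; rewrite inE.
case: leqP => [mu_le1|mu_gt1]; last by rewrite trace_submod_sum0 ?young_group_sum.
rewrite (eq_bigr (fun=> 1)) => [|s Gs]; first by rewrite sumr_const cardsT card_Sn.
apply: trace_submod_fixed; rewrite ?young_onerow ?young_onerow_neq0 // => g _.
exact: young_onerow_fixed.
Qed.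

End YoungSymmetrizer.
End Specht.

(** * Cycle types and conjugacy classes *)

Section CycleType.
Local Open Scope nat_scope.
Local Open Scope group_scope.
Variable n : nat.
Implicit Types (s t x : 'S_n) (B : {set 'I_n}).

Lemma sort_geq_eq (u v : seq nat) : perm_eq u v -> sort geq u = sort geq v.
Proof.
move=> uv; apply/perm_sortP => //.
- by move=> i j; apply: leq_total.
- by move=> i j k /= h1 h2; apply: leq_trans h2 h1.
- by move=> i j; rewrite andbC => /anti_leq.
Qed.

Lemma cycle_type_seq s (bs : seq {set 'I_n}) :
  uniq bs -> bs =i porbits s -> cycle_type s = sort geq [seq #|B| | B <- bs].
Proof.
move=> bs_uniq bsE; apply: sort_geq_eq; apply: perm_map; apply: uniq_perm.
- exact: enum_uniq.
- by [].
by move=> B; rewrite mem_enum bsE.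
Qed.

Lemma cycle_type_partition s : cycle_type s \in partitions n.
Proof.
rewrite mem_partitions; apply/andP; split; last first.
  have -> : sumn (cycle_type s) = sumn [seq #|B| | B : {set 'I_n} in porbits s].
    by apply: perm_sumn; rewrite perm_sort.
  rewrite sumnE big_map big_enum /=.
  have part : partition (porbits s) [set: 'I_n].
    have -> : porbits s = preim_partition (porbit s) [set: 'I_n].
      apply/setP => B; apply/imsetP/imsetP => -[k _ ->]; exists k; rewrite ?inE //;
        by apply/setP => j; rewrite !inE eq_porbit_mem porbit_sym.
    exact: preim_partitionP.
  by rewrite -(card_partition part) cardsT card_ord.
apply/andP; split; first by apply: sort_sorted => i j; apply: leq_total.
rewrite mem_sort; apply/imageP => -[B /imsetP[k _ ->]] /eqP.
by rewrite eq_sym (negPf (card_porbit_neq0 s k)).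
Qed.

Lemma cycle_typeJ s x : cycle_type (s ^ x) = cycle_type s.
Proof.
rewrite (@cycle_type_seq (s ^ x) [seq x @: B | B : {set 'I_n} <- enum (porbits s)]).
- rewrite -map_comp; congr (sort geq _); apply: eq_map => B /=.
  by rewrite card_imset //; apply: perm_inj.
- by rewrite map_inj_uniq ?enum_uniq //; apply: imset_inj; apply: perm_inj.
have orbJ k : porbit (s ^ x) (x k) = x @: porbit s k.
  apply/setP => j; apply/porbitP/imsetP => [[i ->]|[_ /porbitP[i ->] ->]].
    by exists ((s ^+ i) k); rewrite ?mem_porbit // -conjXg permJ.
  by exists i; rewrite -conjXg permJ.
move=> B; apply/mapP/imsetP => [[B']|[k _ ->]].
  by rewrite mem_enum => /imsetP[k _ ->] ->; exists (x k).
exists (porbit s (x^-1 k)); first by rewrite mem_enum imset_f.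
by rewrite -orbJ permKV.
Qed.

Lemma eq_iter_porbit s k i j :
  (iter i s k == iter j s k) = (i == j %[mod #|porbit s k|]).
Proof.
set c := #|porbit s k|.
have c_gt0 : 0 < c by rewrite lt0n card_porbit_neq0.
have iter_mod m : iter m s k = iter (m %% c) s k.
  rewrite {1}(divn_eq m c) addnC iterD; congr (iter _ _ _).
  by elim: (m %/ c) => // d IH; rewrite mulSn iterD IH iter_porbit.
have nth_tr m : iter (m %% c) s k = nth k (traject s k c) (m %% c).
  by rewrite nth_traject ?ltn_mod.
rewrite iter_mod (iter_mod j) !nth_tr.
by rewrite nth_uniq ?size_traject ?ltn_mod // uniq_traject_porbit.
Qed.

(** Orbits of [s] and [t], sorted by size, are matched by position. With a base point in each, [f]
    sends the [i]-th iterate of one base point to the [i]-th iterate of the other. *)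
Lemma cycle_type_conj s t : cycle_type s = cycle_type t -> exists x, t = s ^ x.
Proof.
move=> eq_st.
pose orbs u : seq {set 'I_n} := sort (relpre (fun B => #|B|) geq) (enum (porbits u)).
have orbsE u : cycle_type u = [seq #|B| | B <- orbs u] by rewrite -sort_map.
have mem_orbs u k : porbit u k \in orbs u by rewrite mem_sort mem_enum imset_f.
have orbs_uniq u : uniq (orbs u) by rewrite sort_uniq enum_uniq.
have orbs_ex u B : B \in orbs u -> exists k, B = porbit u k.
  by rewrite mem_sort mem_enum => /imsetP[k _ ->]; exists k.
have sz_st : size (orbs s) = size (orbs t).
  by have := congr1 size eq_st; rewrite !orbsE !size_map.
pose idx k := index (porbit s k) (orbs s).
have lt_idx k : idx k < size (orbs s) by rewrite index_mem.
pose B' k := nth set0 (orbs t) (idx k).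
have B't k : B' k \in orbs t by rewrite mem_nth // -sz_st.
have card_B' k : #|B' k| = #|porbit s k|.
  have := congr1 (fun l => nth 0 l (idx k)) eq_st.
  rewrite !orbsE (nth_map set0) // (nth_map set0) -?sz_st // => <-.
  by rewrite nth_index.
(* [pick] depends on the orbit alone, so all points of an orbit share their base points; orbits
   being nonempty, the default [k] is never reached. *)
pose rep_s k := odflt k [pick j in porbit s k].
pose rep_t k := odflt k [pick j in B' k].
have rep_sP k : porbit s (rep_s k) = porbit s k.
  rewrite /rep_s; case: pickP => [j|/(_ k)] /=; last by rewrite porbit_id.
  by rewrite -eq_porbit_mem => /eqP.
have rep_tP k : porbit t (rep_t k) = B' k.
  rewrite /rep_t; have [j eB] := orbs_ex _ _ (B't k); rewrite eB.
  case: pickP => [i|/(_ j)] /=; last by rewrite porbit_id.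
  by rewrite -eq_porbit_mem => /eqP.
have rep_eq k j : porbit s k = porbit s j -> rep_s k = rep_s j /\ rep_t k = rep_t j.
  move=> e; have e' : B' k = B' j by rewrite /B' /idx e.
  have [i eB] := orbs_ex _ _ (B't k).
  rewrite /rep_s /rep_t -e' eB e; split.
    by case: pickP => // /(_ j) /=; rewrite porbit_id.
  by case: pickP => // /(_ i) /=; rewrite porbit_id.
pose pos k := index k (traject s (rep_s k) #|porbit s k|).
have iter_pos k : iter (pos k) s (rep_s k) = k.
  have k_in : k \in traject s (rep_s k) #|porbit s k|.
    have <- : #|porbit s (rep_s k)| = #|porbit s k| by rewrite rep_sP.
    by rewrite -porbit_traject rep_sP porbit_id.
  have lt_pos : pos k < #|porbit s k|.
    by rewrite -[X in _ < X](size_traject s (rep_s k)) index_mem.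
  by rewrite -[LHS](nth_traject s lt_pos) nth_index.
pose f k := iter (pos k) t (rep_t k).
have f_orb k : porbit t (f k) = B' k by rewrite /f -permX porbit_perm rep_tP.
have f_inj : injective f.
  move=> k j e; have eB : B' k = B' j by rewrite -!f_orb e.
  have eorb : porbit s k = porbit s j.
    have : idx k == idx j by rewrite -(nth_uniq set0 _ _ (orbs_uniq t)) -?sz_st // -/(B' k) eB.
    by move/eqP=> ei; rewrite -[LHS](nth_index set0 (mem_orbs s k)) -/(idx k) ei nth_index.
  have [es et] := rep_eq _ _ eorb.
  move/eqP: e; rewrite /f et eq_iter_porbit rep_tP card_B' => e.
  rewrite -(iter_pos k) -(iter_pos j) es; apply/eqP.
  by rewrite eq_iter_porbit rep_sP.
have f_s k : f (s k) = t (f k).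
  have eorb : porbit s (s k) = porbit s k by rewrite -[s k]/((s ^+ 1) k) porbit_perm.
  have [es et] := rep_eq _ _ eorb; rewrite /f et -iterS; apply/eqP.
  rewrite eq_iter_porbit rep_tP card_B' -rep_sP -eq_iter_porbit.
  by rewrite -{1}es iter_pos iterS iter_pos.
exists (perm f_inj); apply/permP => k.
by rewrite -[k](permKV (perm f_inj)) permJ !permE f_s.
Qed.

End CycleType.

Section CycleTypeSurj.
Local Open Scope nat_scope.
Variable eta : seq nat.
Hypothesis Peta : is_partition eta.
Let n := sumn eta.

Let row (k : 'I_n) := reshape_index eta k.
Let off (k : 'I_n) := reshape_offset eta k.
Let len (k : 'I_n) := nth 0 eta (row k).

Lemma off_lt k : off k < len k.
Proof. exact: reshape_offsetP. Qed.

Lemma row_off_inj k j : row k = row j -> off k = off j -> k = j.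
Proof.
move=> e e'; apply/val_inj; rewrite -[LHS](reshape_indexK eta) -[RHS](reshape_indexK eta).
by rewrite -/(row k) -/(off k) e e'.
Qed.

Lemma rotate_subproof k : flatten_index eta (row k) ((off k).+1 %% len k) < n.
Proof. by apply: flatten_indexP; rewrite ltn_mod (leq_ltn_trans _ (off_lt k)). Qed.

(** Each row of the diagram becomes one cycle, which makes the row lengths the cycle lengths. *)
Definition rotate_rows k : 'I_n := Ordinal (rotate_subproof k).

Lemma row_rotate k : row (rotate_rows k) = row k.
Proof. by rewrite /row flatten_indexKl // ltn_mod (leq_ltn_trans _ (off_lt k)). Qed.

Lemma off_rotate k : off (rotate_rows k) = (off k).+1 %% len k.
Proof. by rewrite /off flatten_indexKr // ltn_mod (leq_ltn_trans _ (off_lt k)). Qed.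

Lemma rotate_rows_inj : injective rotate_rows.
Proof.
move=> k j e; have er : row k = row j by rewrite -row_rotate e row_rotate.
apply: row_off_inj => //; have := congr1 off e; rewrite !off_rotate /len -er.
move/eqP; rewrite -addn1 -[X in _ == X %% _]addn1 eqn_modDr.
by rewrite !modn_small ?off_lt // 1?er ?off_lt // => /eqP.
Qed.

Let s : 'S_n := perm rotate_rows_inj.

Lemma iter_rotate i k : row (iter i s k) = row k /\
  off (iter i s k) = (off k + i) %% len k.
Proof.
elim: i => [|i [IHr IHo]] /=; first by rewrite addn0 modn_small ?off_lt.
by rewrite permE row_rotate off_rotate {1}/len IHr IHo -/(len k) -addn1 modnDml addn1 addnS.
Qed.

Lemma porbit_rotate k : porbit s k = [set j | row j == row k].
Proof.
apply/setP => j; rewrite inE; apply/porbitP/eqP => [[i ->]|e].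
  by rewrite permX (iter_rotate i k).1.
exists (off j + (len k - off k)); rewrite permX.
have [er eo] := iter_rotate (off j + (len k - off k)) k.
apply: row_off_inj; rewrite ?er // eo.
have -> : off k + (off j + (len k - off k)) = off j + len k.
  by have := off_lt k; lia.
by rewrite modnDr modn_small // /len -e off_lt.
Qed.

Lemma card_row r : r < size eta -> #|[set j | row j == r]| = nth 0 eta r.
Proof.
move=> lt_r; have lt_c (c : 'I_(nth 0 eta r)) : flatten_index eta r c < n.
  exact: flatten_indexP.
pose F c := Ordinal (lt_c c).
have -> : [set j | row j == r] = F @: [set: 'I_(nth 0 eta r)].
  apply/setP => j; rewrite inE; apply/eqP/imsetP => [e|[c _ ->]]; last first.
    by rewrite /row flatten_indexKl.
  have lt_off : off j < nth 0 eta r by rewrite -e off_lt.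
  exists (Ordinal lt_off) => //; apply: val_inj.
  by rewrite /= -e /row /off reshape_indexK.
rewrite card_imset ?cardsT ?card_ord // => c c' /(congr1 off).
by rewrite /off !flatten_indexKr // => /val_inj.
Qed.

Lemma cycle_type_rotate : cycle_type s = eta.
Proof.
have row_nonempty r : r < size eta -> exists k, row k = r.
  move=> lt_r; have eta_r : 0 < nth 0 eta r by apply: partition_nth_gt0.
  have lt_k : flatten_index eta r 0 < n by apply: flatten_indexP.
  by exists (Ordinal lt_k); rewrite /row flatten_indexKl.
rewrite (@cycle_type_seq _ _ [seq [set j | row j == r] | r <- iota 0 (size eta)]).
- have -> : [seq #|B| | B : {set 'I_n} <-
      [seq [set j | row j == r] | r <- iota 0 (size eta)]] = eta.
    rewrite -map_comp -[RHS](mkseq_nth 0); apply/eq_in_map => r.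
    by rewrite mem_iota => /= lt_r; rewrite card_row.
  apply: (sorted_sort (leT := geq)); last by case/andP: Peta.
  by move=> i j k /= h1 h2; apply: leq_trans h2 h1.
- rewrite map_inj_in_uniq ?iota_uniq // => r r'; rewrite !mem_iota /= => lt_r _ /setP e.
  by have [k ek] := row_nonempty r lt_r; have := e k; rewrite !inE ek eqxx => /esym/eqP.
move=> B; apply/mapP/imsetP => [[r]|[k _ ->]].
  rewrite mem_iota /= => lt_r ->; have [k ek] := row_nonempty r lt_r.
  by exists k => //; rewrite porbit_rotate ek.
by exists (row k); rewrite ?porbit_rotate // mem_iota /= reshape_indexP.
Qed.

Lemma cycle_type_surj : exists s : 'S_(sumn eta), cycle_type s = eta.
Proof. by exists s; apply: cycle_type_rotate. Qed.

End CycleTypeSurj.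

Lemma sum_pred1_seq (V : nmodType) (J : eqType) (r : seq J) (x : J) (v : V) :
  uniq r -> \sum_(j <- r | x == j) v = if x \in r then v else 0.
Proof.
move=> r_uniq; rewrite big_const_seq (eq_count (a2 := pred1 x)) ?count_uniq_mem //.
by case: (x \in r) => //=; rewrite addr0.
Qed.

Lemma sum_fibers_seq (V : nmodType) (I : finType) (J : eqType) (r : seq J)
    (p : I -> J) (F : I -> V) :
  uniq r -> (forall i, p i \in r) ->
  \sum_i F i = \sum_(j <- r) \sum_(i | p i == j) F i.
Proof.
move=> r_uniq p_r; rewrite (exchange_big_dep predT) //=.
by apply: eq_bigr => i _; rewrite sum_pred1_seq // p_r.
Qed.

Section SpechtCharacterSum.
Variable C : numFieldType.
Local Open Scope group_scope.

(** On partitions of [n] the default value in [perm_of_type] is never reached. *)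
Lemma perm_of_typeP n eta : eta \in partitions n -> cycle_type (perm_of_type n eta) = eta.
Proof.
move=> eta_n; rewrite /perm_of_type; case: pickP => [s /eqP //|none].
move: eta_n none; rewrite mem_partitions => /andP[Peta /eqP <-] none.
by have [s es] := cycle_type_surj Peta; have := none s; rewrite es eqxx.
Qed.

Lemma cycle_type_class n (s t : 'S_n) :
  (cycle_type s == cycle_type t) = (s \in t ^: [set: 'S_n]).
Proof.
apply/eqP/imsetP => [/esym/cycle_type_conj[x ->]|[x _ ->]]; first by exists x.
by rewrite cycle_typeJ.
Qed.

Lemma card_class_cent n (t : 'S_n) : (#|t ^: [set: 'S_n]| * #|'C[t]| = n`!)%N.
Proof.
have <- : #|'C_([set: 'S_n])[t]| = #|'C[t]| by rewrite setTI.
by rewrite -index_cent1 mulnC -card_Sn -cardsT Lagrange // subsetIl.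
Qed.

(** The trace is constant on the class of cycle type [eta], whose cardinal is [n!] over the order of
    the centralizer. *)
Lemma sum_repr_class n (G := [set: 'S_n]%G) m (rG : mx_representation C G m) :
  (\sum_(eta <- partitions n)
     \tr (rG (perm_of_type n eta)) / #|'C[perm_of_type n eta]|%:R
   = (\sum_(s : 'S_n) \tr (rG s)) / n`!%:R)%R.
Proof.
rewrite (sum_fibers_seq _ (partitions_uniq n) (@cycle_type_partition n)) mulr_suml.
apply: eq_big_seq => eta eta_n; set t := perm_of_type n eta.
have tJ x : (\tr (rG (t ^ x)%g) = \tr (rG t))%R.
  rewrite !repr_mxM ?inE ?groupM ?groupV ?inE // mxtrace_mulC -mulmxA.
  by rewrite -repr_mxM ?inE // mulgV repr_mx1 mulmx1.
rewrite (eq_bigl (fun s => s \in t ^: G)) => [|s]; last first.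
  by rewrite -cycle_type_class perm_of_typeP.
rewrite (eq_bigr (fun=> \tr (rG t)))%R => [|s /imsetP[x _ ->]]; last exact: tJ.
rewrite sumr_const -(mulr_natr (\tr (rG t))) -(card_class_cent t) natrM -mulrA.
congr (_ * _)%R.
have nz k : (0 < k)%N -> (k%:R != 0 :> C)%R by rewrite pnatr_eq0 lt0n.
rewrite invfM mulrA divff ?mul1r // nz // lt0n.
by apply/eqP => c0; have := card_class_cent t; rewrite c0 mul0n; have := fact_gt0 n; lia.
Qed.

Lemma sum_specht_char mu : is_partition mu ->
  (\sum_(eta <- partitions (sumn mu)) specht_char C mu eta / (zee eta)%:R
   = (size mu <= 1)%N%:R)%R.
Proof.
move=> Pmu.
transitivity ((\sum_(s : 'S_(sumn mu)) \tr (specht_repr C mu s)) / (sumn mu)`!%:R)%R.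
  rewrite -sum_repr_class; apply: eq_big_seq => eta.
  by rewrite mem_partitions /zee => /andP[_ /eqP ->].
rewrite sum_trace_specht //; case: leqP => _; last by rewrite mul0r.
by rewrite divff // pnatr_eq0 -lt0n fact_gt0.
Qed.

End SpechtCharacterSum.

(** * Power sum specialization and the wave function *)

Lemma partitions0 : partitions 0 = [:: [::]].
Proof.
have mem0 mu : (mu \in partitions 0) = (mu == [::]).
  rewrite mem_partitions; apply/andP/eqP => [[Pmu /eqP mu0]|-> //].
  by apply: size0nil; by have := leq_size_sumn Pmu; rewrite mu0 leqn0 => /eqP.
have := partitions_uniq 0; move: mem0; case: (partitions 0) => [|x r] mem0.
  by have := mem0 [::]; rewrite eqxx.
have /eqP-> : x == [::] by rewrite -mem0 mem_head.
case: r mem0 => // y r mem0 /=; rewrite inE negb_or.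
have /eqP-> : y == [::] by rewrite -mem0 !inE eqxx orbT.
by rewrite eqxx.
Qed.

Section PowerSumSpecialization.
Variables (A : comUnitRingType) (u : A).
Implicit Types f g : seq nat -> A.

(* The substitution p_k := u x^k. *)
Definition pspec f : {fps A} := \fps_d (\sum_(mu <- partitions d) u ^+ size mu * f mu).

Lemma eq_pspec f g : (forall mu, is_partition mu -> f mu = g mu) -> pspec f = pspec g.
Proof.
move=> e; apply: fpsP => d /=; apply: eq_big_seq => mu.
by rewrite mem_partitions => /andP[/e-> _].
Qed.

Lemma pspec_one : pspec (@pser_one A) = 1.
Proof.
apply: fpsP => d; rewrite coefs1 /= (bigID (fun mu => [::] == mu)) /=.
rewrite [X in _ + X]big1 => [|mu]; last by rewrite /pser_one eq_sym => /negPf->; rewrite mulr0.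
rewrite (eq_bigr (fun=> 1)) => [|mu /eqP <-]; last by rewrite mul1r.
rewrite addr0 sum_pred1_seq ?partitions_uniq // mem_partitions /=.
by rewrite eq_sym; case: eqP.
Qed.

Lemma perm_eq_partition (l mu : seq nat) : is_partition mu ->
  perm_eq l mu = (sort geq l == mu).
Proof.
case/andP=> mu_sorted _; apply/idP/eqP => [/sort_geq_eq->|<-].
  apply: (sorted_sort (leT := geq)) => // i j k /= h1 h2; exact: leq_trans h2 h1.
by rewrite perm_sym perm_sort.
Qed.

Lemma partition_cat al be d d' : al \in partitions d -> be \in partitions d' ->
  sort geq (al ++ be) \in partitions (d + d').
Proof.
rewrite !mem_partitions => /andP[/andP[_ al0] /eqP <-] /andP[/andP[_ be0] /eqP <-].
rewrite /is_partition mem_sort mem_cat negb_or al0 be0 sort_sorted /=; last first.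
  by move=> i j; apply: leq_total.
by rewrite (perm_sumn (_ : perm_eq _ (al ++ be))) ?perm_sort // sumn_cat.
Qed.

(** Each pair [(al, be)] contributes to exactly one [mu], its sorted concatenation, and the number
    of parts is additive. *)
Lemma pspec_mul f g : pspec (pser_mul f g) = pspec f * pspec g.
Proof.
apply: fpsP => d; rewrite coefsM /=.
transitivity (\sum_(mu <- partitions d) \sum_(d' < d.+1) \sum_(al <- partitions d')
    \sum_(be <- partitions (d - d') | sort geq (al ++ be) == mu)
       u ^+ size (al ++ be) * (f al * g be)).
  apply: eq_big_seq => mu; rewrite mem_partitions => /andP[Pmu /eqP mud].
  rewrite /pser_mul mud mulr_sumr; apply: eq_bigr => d' _.
  rewrite mulr_sumr; apply: eq_bigr => al _; rewrite mulr_sumr.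
  apply: eq_big => be; first exact: perm_eq_partition.
  by move/perm_size <-.
rewrite exchange_big; apply: eq_bigr => d' _.
rewrite exchange_big mulr_suml; apply: eq_big_seq => al al_d.
rewrite (exchange_big_dep predT) //= mulr_sumr; apply: eq_big_seq => be be_d.
rewrite sum_pred1_seq ?partitions_uniq //.
have le_d' : (d' <= d)%N by rewrite -ltnS.
have := partition_cat al_d be_d; rewrite subnKC // => ->.
by rewrite size_cat exprD; ring.
Qed.

Lemma pspec_pow f n : pspec (pser_pow f n) = pspec f ^+ n.
Proof.
elim: n => [|n IH]; first exact: pspec_one.
by rewrite exprS -IH -pspec_mul.
Qed.

Lemma pspec_exp f : pspec (pser_exp f) = fps_exp (pspec f).
Proof.
apply: fpsP => d; rewrite [RHS]/=.
under [RHS]eq_bigr => n _ do rewrite -pspec_pow /= mulr_sumr.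
rewrite exchange_big; apply: eq_big_seq => mu.
rewrite mem_partitions => /andP[_ /eqP mud]; rewrite /pser_exp mud mulr_sumr.
by apply: eq_bigr => n _; rewrite mulrCA.
Qed.

End PowerSumSpecialization.

(** * The exponent of the wave function as a specialized free energy *)

Section LogWave.
Variable C : numClosedFieldType.

Lemma scalM (c d : C) : scal (c * d) = scal c * scal d.
Proof. by rewrite /scal fps_constM rmorphM. Qed.

Lemma scal1 : scal (1 : C) = 1.
Proof. exact: rmorph1. Qed.

Lemma scalX (c : C) n : scal (c ^+ n) = scal c ^+ n.
Proof. by elim: n => [|n IH]; rewrite ?scal1 // !exprS scalM IH. Qed.

Lemma scal_nat n : scal (n%:R : C) = n%:R.
Proof.
rewrite /scal; have -> : fps_const (n%:R : C) = n%:R.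
  by apply: fpsP => k; rewrite coefs_natr.
by rewrite rmorph_nat.
Qed.

Lemma scal_sum (I : Type) (r : seq I) (f : I -> C) :
  scal (\sum_(i <- r) f i) = \sum_(i <- r) scal (f i).
Proof.
apply: (big_morph (@scal C)) => [c d|]; last exact: (scal_nat 0).
by rewrite /scal fps_constD rmorphD.
Qed.

Lemma coefs_NTXM (f : coefring C) j m :
  coefs ((- T) ^+ j * f) m = if (j <= m)%N then (-1) ^+ j * coefs f (m - j) else 0.
Proof. exact: coefs_NXnM. Qed.

Lemma tconstM (x y : laurent C) : tconst (x * y) = tconst x * tconst y.
Proof. exact: fps_constM. Qed.

Lemma tconst1 : tconst (1 : laurent C) = 1.
Proof. by []. Qed.

Lemma tconstX (x : laurent C) n : tconst (x ^+ n) = tconst x ^+ n.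
Proof. by elim: n => [|n IH]; rewrite // !exprS tconstM IH. Qed.

Lemma tconst_nat n : tconst (n%:R : laurent C) = n%:R.
Proof. by apply: fpsP => k; rewrite coefs_natr. Qed.

Lemma laurent_nat_neq0 n : n.+1%:R != 0 :> laurent C.
Proof.
rewrite -scal_nat tofrac_eq0; apply/eqP => /(congr1 (fun f => coefs f 0%N)) /= /eqP.
by rewrite pnatr_eq0.
Qed.

Definition genus_coef (f : nat -> {fps C}) k : {fps C} :=
  \fps_j (if odd j then 0 else coefs (f j./2) k).

Lemma coefs_genus_sum n (f : nat -> {fps C}) k :
  coefs (genus_sum n f) k
  = ((lam C)%:F : laurent C) ^ (n%:Z - 2%:Z) * (genus_coef f k)%:F.
Proof. by []. Qed.

Lemma genus_coefE f k j :
  coefs (genus_coef f k) j = if odd j then 0 else coefs (f j./2) k.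
Proof. by []. Qed.

Lemma genus_sumD n (f g : nat -> {fps C}) :
  genus_sum n (fun k => f k + g k) = genus_sum n f + genus_sum n g.
Proof.
apply: fpsP => k; rewrite [RHS]coefsD !coefs_genus_sum -mulrDr -rmorphD.
congr (_ * tofrac _).
apply: fpsP => j; rewrite coefsD !genus_coefE coefsD.
by case: odd; rewrite ?addr0.
Qed.

Lemma genus_sum0 n : genus_sum n (fun=> 0 : {fps C}) = 0.
Proof.
apply: fpsP => k; rewrite coefs_genus_sum coefs0.
have -> : genus_coef (fun=> 0) k = 0.
  by apply: fpsP => j; rewrite genus_coefE !coefs0 if_same.
by rewrite rmorph0 mulr0.
Qed.

Lemma genus_sum_sum (I : Type) (r : seq I) (P : pred I) n (f : I -> nat -> {fps C}) :
  genus_sum n (fun k => \sum_(i <- r | P i) f i k) = \sum_(i <- r | P i) genus_sum n (f i).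
Proof.
elim: r => [|i r IH].
  rewrite big_nil -[RHS](genus_sum0 n); congr genus_sum.
  by apply/funext => k; rewrite big_nil.
rewrite big_cons -IH; case: ifP => Pi; rewrite -?genus_sumD; congr genus_sum;
  by apply/funext => k; rewrite big_cons Pi.
Qed.

Lemma genus_sumZ n (c : C) (f : nat -> {fps C}) :
  genus_sum n (fun k => fps_const c * f k) = tconst (scal c) * genus_sum n f.
Proof.
apply: fpsP => k; rewrite coefs_constM !coefs_genus_sum mulrCA -rmorphM.
congr (_ * tofrac _); apply: fpsP => j.
rewrite coefs_constM !genus_coefE coefs_constM.
by case: odd; rewrite ?mulr0.
Qed.

(** For given [mu] and [sigma] exactly one monomial qualifies, so all [n!] permutations count even
    when parts repeat; this factor cancels the [1/n!] of [log_wave]. *)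
Lemma coefs_diag_Phi (F : nat -> nat -> seq nat -> C) g n d :
  coefs (diag_spec (@Phi C F g n)) d
  = \sum_(mu <- partitions d | size mu == n)
      fps_const (n`!%:R * 'i ^+ n) * \fps_k F g k mu.
Proof.
rewrite /= (eq_bigr (fun al : {ffun 'I_n -> 'I_d.+1} =>
  \sum_(mu <- partitions d | size mu == n)
    \sum_(sigma : 'S_n | [forall i, al (sigma i) == nth 0%N mu i :> nat])
      \fps_k ('i ^+ n * F g k mu))); last by move=> al /eqP ed; rewrite /Phi /= ed.
rewrite exchange_big big_seq_cond [RHS]big_seq_cond.
apply: eq_bigr => mu /andP[mu_d /eqP mu_n].
rewrite (exchange_big_dep predT) //=.
rewrite (eq_bigr (fun=> \fps_k ('i ^+ n * F g k mu))) => [|sigma _].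
  rewrite sumr_const card_Sn; apply: fpsP => k.
  by rewrite coefsMn coefs_constM -mulrA -(mulr_natl (coefs _ _)).
move: mu_d; rewrite mem_partitions => /andP[_ /eqP mu_sum].
pose al0 : {ffun 'I_n -> 'I_d.+1} := [ffun i => inord (nth 0%N mu (sigma^-1 i)%g)].
have sum_mu : (\sum_(i < n) nth 0%N mu i = d)%N by rewrite -sumn_nth ?mu_n.
have al0E i : al0 (sigma i) = nth 0%N mu i :> nat.
  rewrite ffunE permK inordK // ltnS -sum_mu (bigD1 i) //=; exact: leq_addr.
rewrite (big_pred1 al0) // => al; apply/andP/eqP => [[_ /forallP al_mu]|->].
  apply/ffunP => i; apply: val_inj.
  by rewrite -(permKV sigma i) /= (eqP (al_mu _)) al0E.
split; last by apply/forallP => i; rewrite al0E.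
rewrite (reindex_inj (@perm_inj _ sigma)) -[X in _ == X]sum_mu.
by apply/eqP/eq_bigr => i _; rewrite al0E.
Qed.

Lemma log_wave_pspec (F : nat -> nat -> seq nat -> C) :
  log_wave F = pspec (tconst (scal 'i)) (free_energy F).
Proof.
apply: fpsP => d.
have factU n : n`!%:R \is a @GRing.unit (coefring C).
  rewrite fps_unitE coefs_natr unitfE; case: n`! (fact_gt0 n) => // k _.
  exact: laurent_nat_neq0.
have termE n : (n`!%:R)^-1 * genus_sum n (fun g => coefs (diag_spec (@Phi C F g n)) d)
    = \sum_(mu <- partitions d | size mu == n)
        tconst (scal 'i) ^+ n * genus_sum n (fun g => \fps_k F g k mu).
  have -> : (fun g => coefs (diag_spec (@Phi C F g n)) d) = (fun g =>
      \sum_(mu <- partitions d | size mu == n)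
        fps_const (n`!%:R * 'i ^+ n) * \fps_k F g k mu).
    by apply/funext => g; rewrite coefs_diag_Phi.
  rewrite genus_sum_sum mulr_sumr; apply: eq_bigr => mu _.
  rewrite genus_sumZ scalM scal_nat scalX tconstM tconst_nat tconstX.
  by rewrite !mulrA mulVr ?factU // mul1r.
transitivity (\sum_(1 <= n < d.+1) \sum_(mu <- partitions d | size mu == n)
    tconst (scal 'i) ^+ n * genus_sum n (fun g => \fps_k F g k mu)).
  by apply: eq_bigr => n _; rewrite termE.
(* Each nonempty [mu] is met once, at [n = size mu], which is at most [d]; the empty one falls
   outside the range and has zero free energy. *)
rewrite (exchange_big_dep predT) //= -/(pspec _ _); apply: eq_big_seq => mu.
rewrite mem_partitions => /andP[Pmu /eqP mu_sum].
case: mu => [|m mu] in Pmu mu_sum *.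
  by rewrite -mu_sum big_geq // mulr0.
rewrite (eq_bigr (fun=> tconst (scal 'i) ^+ (size mu).+1 *
  genus_sum (size mu).+1 (fun g => \fps_k F g k (m :: mu)))) => [|n /eqP <- //].
rewrite sum_pred1_seq ?iota_uniq // mem_index_iota.
have := leq_size_sumn Pmu; rewrite mu_sum ltnS /= => ->.
by [].
Qed.

End LogWave.

(** * The amplitude *)

Section QPow.
Variable C : numClosedFieldType.
Implicit Types (b c : C).

Lemma natU_closed n : n.+1%:R \is a @GRing.unit C.
Proof. by rewrite unitfE pnatr_eq0. Qed.

Lemma coefs0_exponent c : coefs (fps_const c * lam C) 0 = 0.
Proof. by rewrite coefs_constM mulr0. Qed.

Lemma qpowD b c : qpow (b + c) = qpow b * qpow c.
Proof.
rewrite /qpow -rmorphM mulrDr fps_constD mulrDl; congr tofrac.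
by rewrite fps_expD ?coefs0_exponent //; apply: natU_closed.
Qed.

Lemma qpow0 : qpow (0 : C) = 1.
Proof.
have z : fps_const (0 : C) * lam C = 0.
  by apply: fpsP => n; rewrite coefs_constM mul0r.
rewrite /qpow mulr0 z -[RHS](rmorph1 (@tofrac _)); congr tofrac; apply/esym.
apply: fps_exp_unique => //; first exact: natU_closed.
have -> : (1 : {fps C}) = fps_const 1 by [].
rewrite fps_euler_const -[X in fps_euler X]z fps_euler_constM.
by apply: fpsP => n; rewrite -mulrA coefs_constM mul0r.
Qed.

Lemma qpow_neq0 b : qpow b != 0.
Proof.
apply: contra_eq_neq qpow0 => b0; rewrite -[0](subrr b) qpowD b0 mul0r.
by rewrite eq_sym oner_eq0.
Qed.

Lemma qpowN b : qpow (- b) = (qpow b)^-1.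
Proof.
by apply: (mulfI (qpow_neq0 b)); rewrite -qpowD subrr qpow0 divff ?qpow_neq0.
Qed.

Lemma qpowX b n : qpow b ^+ n = qpow (b * n%:R).
Proof.
elim: n => [|n IH]; first by rewrite mulr0 qpow0.
have -> : b * n.+1%:R = b + b * n%:R by rewrite -natr1; ring.
by rewrite exprS IH qpowD.
Qed.

Lemma qpowXz b (k : int) : qpow b ^ k = qpow (b * k%:~R).
Proof.
case: k => n; first by rewrite -exprnP qpowX.
by rewrite NegzE -exprnN qpowX mulrNz mulrN qpowN.
Qed.

Lemma qnumE n : qpow (1 / 2%:R : C) ^+ n - qpow (1 / 2%:R : C) ^- n = qnum C n.
Proof. by rewrite qpowX mulrC mulrA mulr1 /qnum qpowN. Qed.

(** The coefficient of [lambda] is ['i * n.+1%:R]. *)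
Lemma qnum_neq0 n : qnum C n.+1 != 0.
Proof.
have exp1 c : coefs (fps_exp (fps_const c * lam C)) 1 = c.
  set f := fps_const c * lam C.
  transitivity (\sum_(k < 2) (k`!%:R)^-1 * coefs (f ^+ k) 1); first by [].
  rewrite big_ord_recr big_ord1 expr0 coefs1 mulr0 [LHS]add0r expr1 coefs_constM.
  by rewrite invr1 mul1r mulr1.
rewrite /qnum -rmorphB tofrac_eq0; apply/eqP => /(congr1 (fun f => coefs f 1%N)) e.
have : 'i * (n.+1%:R / 2%:R) - 'i * (- (n.+1%:R / 2%:R)) = 0 :> C.
  by rewrite -(exp1 ('i * _)) -(exp1 ('i * - _)).
move/eqP; rewrite -mulrBr opprK -splitr mulf_eq0 pnatr_eq0 orbF.
by rewrite (negPf (neq0Ci C)).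
Qed.

End QPow.

(** * Reduction to one-row partitions and the recursion in x *)

Section Amplitude.
Variable C : numClosedFieldType.

Let s : laurent C := qpow (1 / 2%:R : C).
Let h : nat -> laurent C := hsym (@p_rho C).
Let e : nat -> laurent C := elsym s h.

Lemma q_half_neq0 : s != 0.
Proof. exact: qpow_neq0. Qed.

Lemma hsym_rho_rec n : h n.+1 * (s ^+ 2 ^+ n.+1 - 1) = s ^+ n.*2.+1 * h n.
Proof.
apply: hsym_rec => [k||k|k].
- exact: laurent_nat_neq0.
- exact: q_half_neq0.
- by rewrite qnumE qnum_neq0.
- by rewrite qnumE.
Qed.

Lemma hsym_rho0 : h 0 = 1.
Proof. exact: hsym0. Qed.

Lemma onerow_partition d : onerow d \in partitions d.
Proof. by case: d => [|d]; rewrite mem_partitions //= addn0 eqxx. Qed.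

Lemma size_le1_onerow d mu : mu \in partitions d -> (size mu <= 1)%N = (onerow d == mu).
Proof.
rewrite mem_partitions => /andP[/andP[_ mu0] /eqP <-].
case: mu mu0 => [|[|m] [|m' mu]] //= _; first by rewrite addn0 eqxx.
by apply/esym/eqP; case: (m.+1 + _)%N.
Qed.

Lemma sum_onerow (V : nmodType) d (X : seq nat -> V) :
  (forall mu, mu \in partitions d -> (1 < size mu)%N -> X mu = 0) ->
  \sum_(mu <- partitions d) X mu = X (onerow d).
Proof.
move=> X0; rewrite (bigID (fun mu => onerow d == mu)) /= [X in _ + X]big_seq_cond.
rewrite [X in _ + X]big1 ?addr0 => [|mu /andP[mu_d]]; last first.
  by rewrite -size_le1_onerow // -ltnNge; apply: X0.
rewrite (eq_bigr (fun=> X (onerow d))) => [|mu /eqP <- //].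
by rewrite sum_pred1_seq ?partitions_uniq // onerow_partition.
Qed.

Lemma skew_schur_row_onerow (p : nat -> laurent C) d j : (j <= d)%N ->
  skew_schur p (onerow d) (onerow j) = hsym p (d - j).
Proof.
move=> le_jd; rewrite (@skew_schur_onerow _ _ 1) ?size_onerow ?leq_b1 //.
rewrite /jacobi_trudi det_mx11 mxE !nth_onerow /= subr0 addr0 seqzB.
by rewrite le_jd.
Qed.

(* The last row of the Jacobi-Trudi matrix vanishes. *)
Lemma skew_schur_row_0 (p : nat -> laurent C) d eta : is_partition eta ->
  (1 < size eta)%N -> skew_schur p (onerow d) eta = 0.
Proof.
move=> Peta eta_gt1; rewrite /skew_schur.
have -> : maxn (size (onerow d)) (size eta) = size eta.
  by apply/maxn_idPr; rewrite size_onerow; lia.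
have lt_i : ((size eta).-1 < size eta)%N by lia.
rewrite (expand_det_row _ (Ordinal lt_i)) big1 // => j _.
rewrite mxE nth_onerow /=; have -> : ((size eta).-1 == 0)%N = false by lia.
have := partition_nth_gt0 Peta (ltn_ord j); have := ltn_ord j.
by move=> ? ?; rewrite -[hsymz _ _]/(seqz _ _) seqz_neg ?mul0r //; lia.
Qed.

Lemma vertex2_onerow d nu :
  vertex2 C (onerow d) nu = qpow (- ((kappa nu)%:~R / 2%:R)) *
    \sum_(j < d.+1) h (d - j) * skew_schur (@p_rho C) nu (onerow j).
Proof.
rewrite /vertex2 sumn_onerow; congr (_ * _); apply: eq_bigr => j _.
rewrite sum_onerow => [|mu]; first by rewrite skew_schur_row_onerow // -ltnS.
by rewrite mem_partitions => /andP[Pmu _] mu_gt1; rewrite skew_schur_row_0 ?mul0r.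
Qed.

(** Up to [(-1) ^+ m], the coefficient of [T^m] in the normalizing amplitude
    ([open_amplitude_empty]). *)
Definition closed_term m := \sum_(nu <- partitions m)
  jacobi_trudi (size nu) e nu 0 * jacobi_trudi (size nu) h nu 0.

Lemma sum_vertices m j :
  \sum_(nu <- partitions m) qpow (- ((kappa nu)%:~R / 2%:R)) *
     skew_schur (@p_rho C) nu (onerow j) * vertex1 C nu
  = if (j <= m)%N then e j * closed_term (m - j) else 0.
Proof.
have e0 : e 0 = 1 := elsym0 s hsym_rho0.
have closedE N k : (k <= N)%N ->
    closed_term k = \sum_(nu <- partitions k) jacobi_trudi N e nu 0 * jacobi_trudi N h nu 0.
  move=> le_kN; apply: eq_big_seq => nu /size_partitions le_nu.
  have le_N := leq_trans le_nu le_kN.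
  by rewrite !(@jacobi_trudi_widen _ (size nu) N) ?hsym_rho0.
(* Size [m.+1] instead of [m], since the pairing asks for a nonempty matrix even when [m = 0]. *)
rewrite (@closedE m.+1) ?(leq_trans (leq_subr _ _)) // -schur_pairing ?hsym_rho0 //.
apply: eq_big_seq => nu /size_partitions le_nu.
have le_N : (size nu <= m.+1)%N by apply: leqW.
rewrite mulrAC (jacobi_trudi_elsym q_half_neq0 hsym_rho0 hsym_rho_rec le_N).
rewrite (skew_schur_onerow _ le_N) ?size_onerow; last by case: (j).
rewrite /vertex1 /schur -[[::]]/(onerow 0) (skew_schur_onerow _ le_N) //.
have <- : s ^ (- kappa nu) = qpow (- ((kappa nu)%:~R / 2%:R) : C).
  by rewrite /s qpowXz mulrNz; congr qpow; field.
by [].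
Qed.

Lemma kappa_onerow d : kappa (onerow d) = d%:Z * (d%:Z - 1).
Proof.
case: d => [|d]; first by rewrite /kappa big_ord0.
by rewrite /kappa big_ord1 /=; ring.
Qed.

Variable a : C.

Let framing d : laurent C := qpow (a * (kappa (onerow d))%:~R / 2%:R).

(** [kappa] of one row grows by [2 d] from [(d)] to [(d + 1)]; this is the origin of the power [a]
    of [yhat] in the operator. *)
Lemma framingS d : framing d.+1 = framing d * qpow (a * d%:R).
Proof.
rewrite /framing -qpowD !kappa_onerow; congr qpow.
have -> : d.+1%:Z = d%:Z + 1 by lia.
have -> : d%:R = d%:~R :> C by [].
by rewrite !(intrM, intrB, intrD); field.
Qed.

Let W d : coefring C :=
  \sum_(eta <- partitions d) tconst (scal 'i) ^+ size eta * open_amplitude a eta.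

Lemma amplitude_sum0 : W 0 = open_amplitude a [::].
Proof. by rewrite /W partitions0 big_seq1 mul1r. Qed.

Let closed_series : coefring C := \fps_m ((-1) ^+ m * closed_term m).

Let P d : coefring C := \sum_(j < d.+1) tconst (h (d - j) * e j) * (- T) ^+ j.

Lemma amplitude_sumE d : W d = tconst (framing d) * (P d * closed_series).
Proof.
apply: fpsP => m; rewrite coefs_constM /W coefs_sum /P mulr_suml coefs_sum.
pose X mu nu := qpow (a * (kappa mu)%:~R / 2%:R) * vertex2 C mu nu * (-1) ^+ m * vertex1 C nu.
transitivity (\sum_(mu <- partitions d) \sum_(nu <- partitions m)
    X mu nu * scal ((size mu <= 1)%N%:R : C)).
  transitivity (\sum_(eta <- partitions d) \sum_(mu <- partitions d)
      \sum_(nu <- partitions m) X mu nu * scal (specht_char C mu eta / (zee eta)%:R)).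
    apply: eq_big_seq => eta; rewrite mem_partitions => /andP[_ /eqP eta_sum].
    rewrite -tconstX coefs_constM -scalX exchange_big /= eta_sum mulr_sumr.
    apply: eq_bigr => nu _; rewrite mulr_sumr; apply: eq_bigr => mu _.
    rewrite mulrCA -scalM; congr (_ * scal _).
    have i_neq0 : 'i ^+ size eta != 0 :> C by rewrite expf_neq0 ?neq0Ci.
    by rewrite invfM mulrCA [X in _ * X]mulrCA divff // mulr1.
  rewrite exchange_big; apply: eq_big_seq => mu mu_d.
  have := mu_d; rewrite mem_partitions => /andP[Pmu /eqP mu_sum].
  rewrite exchange_big; apply: eq_bigr => nu _.
  by rewrite -mulr_sumr -scal_sum -mu_sum sum_specht_char.
transitivity (\sum_(nu <- partitions m) X (onerow d) nu).
  pose Y mu := \sum_(nu <- partitions m) X mu nu * scal ((size mu <= 1)%N%:R : C).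
  have Y0 mu : mu \in partitions d -> (1 < size mu)%N -> Y mu = 0.
    move=> _; rewrite ltnNge /Y => /negPf ->; apply: big1 => nu _.
    by rewrite (scal_nat C 0) mulr0.
  rewrite (sum_onerow Y0); apply: eq_bigr => nu _.
  by rewrite size_onerow leq_b1 scal1 mulr1.
rewrite /X; under eq_bigr => nu _ do rewrite vertex2_onerow -/(framing d) -!mulrA.
rewrite -mulr_sumr; congr (_ * _).
transitivity (\sum_(j < d.+1) (h (d - j) * (-1) ^+ m) *
   \sum_(nu <- partitions m) qpow (- ((kappa nu)%:~R / 2%:R)) *
     skew_schur (@p_rho C) nu (onerow j) * vertex1 C nu).
  rewrite (eq_bigr _ (fun j _ => mulr_sumr _ _ _ _)) exchange_big.
  apply: eq_bigr => nu _ /=; rewrite mulr_suml mulr_sumr; apply: eq_bigr => j _.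
  ring.
apply: eq_bigr => j _; rewrite sum_vertices -[in RHS]mulrA coefs_constM coefs_NTXM.
case: leqP => [le_jm|_]; last by rewrite !mulr0.
have -> : coefs closed_series (m - j) = (-1) ^+ (m - j) * closed_term (m - j) by [].
have -> : (-1) ^+ m = (-1) ^+ j * (-1) ^+ (m - j) :> laurent C by rewrite -exprD subnKC.
ring.
Qed.

Lemma closed_series_unit : closed_series \is a GRing.unit.
Proof.
rewrite fps_unitE /= /closed_term partitions0 big_seq1 /jacobi_trudi !det_mx00.
by rewrite !mul1r unitr1.
Qed.

Lemma open_amplitude_empty : open_amplitude a [::] = closed_series.
Proof.
rewrite -amplitude_sum0 amplitude_sumE /framing kappa_onerow.
rewrite mul0r mulr0 mul0r qpow0 tconst1 mul1r.
by rewrite /P big_ord1 subnn hsym_rho0 /e elsym0 ?hsym_rho0 // mul1r tconst1 !mul1r.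
Qed.

(** [convolution_q_rec] at [Q = q], [s = q^(1/2)] and [t = - T], the last because each [e n] comes
    with [(- T) ^+ n]. *)
Lemma conifold_factor_rec d :
  P d.+1 * (tconst (qpow (1 : C)) ^+ d.+1 - 1)
  = tconst s * (tconst (qpow (1 : C)) ^+ d - T) * P d.
Proof.
have qE : qpow (1 : C) = s ^+ 2 by rewrite qpowX divfK // pnatr_eq0.
pose u n := tconst (h n); pose v n := tconst (e n) * (- T) ^+ n : coefring C.
have PE k : P k = \sum_(j < k.+1) v j * u (k - j)%N.
  by apply: eq_bigr => j _; rewrite tconstM /u /v; ring.
have tconstB n : tconst (qpow (1 : C)) ^+ n - 1 = tconst (s ^+ 2 ^+ n - 1).
  rewrite -tconstX qE /tconst fps_constD; congr (_ + _).
  by apply: fpsP => -[|k] //=; rewrite oppr0.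
rewrite !PE; apply: convolution_q_rec => n.
  rewrite tconstB /u -tconstM hsym_rho_rec qE -tconstX -!tconstM; congr (tconst (_ * _)).
  by rewrite -exprM -exprS mul2n.
have -> : v n.+1 * (tconst (qpow 1) ^+ n.+1 - 1)
    = tconst (e n.+1 * (s ^+ 2 ^+ n.+1 - 1)) * (- T) ^+ n.+1.
  by rewrite tconstB tconstM /v mulrAC.
by rewrite /e (elsym_rec q_half_neq0 hsym_rho_rec) tconstM exprS mulrACA.
Qed.

Lemma coefs_wave (F : nat -> nat -> seq nat -> C) d : is_open_string_amplitude a F ->
  coefs (wave F) d = tconst (framing d) * P d.
Proof.
move=> F_def; rewrite /wave log_wave_pspec -pspec_exp.
rewrite -(eq_pspec _ F_def).
transitivity (W d / closed_series).
  rewrite /W mulr_suml; apply: eq_bigr => eta _.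
  by rewrite /open_amplitude_normalized open_amplitude_empty mulrA.
by rewrite amplitude_sumE mulrA mulrK // closed_series_unit.
Qed.

Lemma wave_q_difference (F : nat -> nat -> seq nat -> C) :
  is_open_string_amplitude a F ->
  let Z := wave F in
  let q12 := tconst (qpow (1 / 2%:R)) in
  Z - yhat 1 Z
    + wconst q12 * xhat (yhat (a + 1) Z)
    - wconst (q12 * T) * xhat (yhat a Z) = 0.
Proof.
move=> F_def; have := fun k => coefs_wave k F_def.
move: (wave F) => Z0 ZE Z q12; apply: fpsP => d.
(* In degree [d.+1] the equation is [conifold_factor_rec] times [f * g], where [f] is the framing
   factor of degree [d], [g] is [q^(a d)] and [Qd] is [q^d]. *)
have step (A : comNzRingType) (Q1 Qd r t w0 w1 f g : A) :
    w1 * (Q1 - 1) = r * (Qd - t) * w0 ->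
    f * g * w1 - Q1 * (f * g * w1) + r * (g * Qd * (f * w0)) - r * t * (g * (f * w0)) = 0.
  move=> rec; transitivity (f * g * (r * (Qd - t) * w0 - w1 * (Q1 - 1))); first by ring.
  by rewrite rec subrr mulr0.
pose x b k : coefring C := if k is k'.+1 then tconst (qpow (b * k'%:R)) * coefs Z k' else 0.
have qpowE k : tconst (qpow (1 * k%:R : C)) = tconst (qpow 1) ^+ k.
  by rewrite -tconstX qpowX.
transitivity (coefs Z d - tconst (qpow (1 * d%:R)) * coefs Z d
    + q12 * x (a + 1) d - q12 * T * x a d).
  have xhatE c b : coefs (wconst c * xhat (yhat b Z)) d = c * x b d.
    transitivity (c * coefs (xhat (yhat b Z)) d); first exact: coefs_constM.
    by congr (_ * _); rewrite /xhat coefs_XM; case: (d).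
  by congr (_ - _ + _ - _); apply: xhatE.
rewrite qpowE; case: d => [|d].
  by rewrite expr0 mul1r subrr /x !mulr0 subr0 addr0.
pose f := tconst (framing d); pose g := tconst (qpow (a * d%:R)).
pose Qd : coefring C := tconst (qpow 1) ^+ d.
have eZ : coefs Z d.+1 = f * g * P d.+1 by rewrite ZE framingS tconstM.
have ex1 : x (a + 1) d.+1 = g * Qd * (f * P d).
  have ea : (a + 1) * d%:R = a * d%:R + 1 * d%:R by rewrite mulrDl.
  by rewrite /x ea qpowD tconstM qpowE ZE.
have ex0 : x a d.+1 = g * (f * P d) by rewrite /x ZE.
transitivity (f * g * P d.+1 - tconst (qpow 1) ^+ d.+1 * (f * g * P d.+1)
    + q12 * (g * Qd * (f * P d)) - q12 * T * (g * (f * P d))).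
  by congr (_ - _ * _ + _ * _ - _ * _).
exact: (step _ _ _ q12 T _ _ _ _ (conifold_factor_rec d)).
Qed.

End Amplitude.

Theorem theorem3p2 (R : realType) (a : R[i])
    (F : nat -> nat -> seq nat -> R[i])
    (F_def : is_open_string_amplitude a F) :
  let Z := wave F in
  let q12 := tconst (qpow (1 / 2%:R)) in
  Z - yhat 1 Z
    + wconst q12 * xhat (yhat (a + 1) Z)
    - wconst (q12 * T) * xhat (yhat a Z) = 0.
Proof. exact: wave_q_difference. Qed.
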